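(* Let $\widehat g_n$ be the NPMLE over $\mathcal P([-a,a])$, and suppose that the true mixing distribution $g_0$ belongs to $\mathcal P([-a,a])$. Then we have the $L^1$ rate for the privatized density $$\|m_{\widehat g_n}-m_{g_0}\|_1=\mathcal O_p\left((1+a/b)^{1/4}e^{a/(2b)}n^{-3/8}\right),$$ and the 1-Wasserstein rate for the mixing distribution $$W_1(\widehat g_n,g_0)=\mathcal O_p\left(a\,r_n+b\sqrt{r_n\log(1/r_n)}\right),\quad r_n:=(1+a/b)^{1/4}e^{a/(2b)}n^{-3/8}.$$ Equivalently, $$W_1(\widehat g_n,g_0)=\mathcal O_p\left(a(1+a/b)^{1/4}e^{a/(2b)}n^{-3/8}+b(1+a/b)^{1/8}e^{a/(4b)}n^{-3/16}\sqrt{\log n}\right).$$ For fixed $a$ and $b$, the second term gives the leading order $$W_1(\widehat g_n,g_0)=\mathcal O_p\left(n^{-3/16}\sqrt{\log n}\right).$$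
   Context: $a>0$ is fixed and known, and $\mathcal P([-a,a])$ is the set of all probability measures on $[-a,a]$. $f_b(z)=\frac{1}{2b}e^{-|z|/b}$, $z\in\mathbb R$, is the Laplace density with known scale $b>0$; for $g\in\mathcal P([-a,a])$, $m_g(x)=\int_{[-a,a]}f_b(x-\theta)\,g(\mathrm d\theta)$, $x\in\mathbb R$. The observations are $X_i=\theta_i+Z_i$, $i=1,\dots,n$, with $\theta_i$ i.i.d. from $g_0$ and $Z_i$ i.i.d. with density $f_b$, the two sequences being independent, so that $X_1,\dots,X_n$ are i.i.d. with density $m_{g_0}$. The NPMLE (nonparametric maximum likelihood estimator) $\widehat g_n$ is a maximizer of $\ell_n(g)=\sum_{i=1}^n\log m_g(X_i)$ over $g\in\mathcal P([-a,a])$. $\|\cdot\|_1$ is the $L^1(\mathbb R)$ norm and $W_1$ is the 1-Wasserstein distance. $\mathcal O_p$ is the usual stochastic order notation as the sample size $n$ grows. *)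

(* Defs.v *)
From HB Require Import structures.
From mathcomp Require Import all_boot all_order all_algebra.
From mathcomp Require Import all_classical all_reals all_analysis.
Set Implicit Arguments.
Unset Strict Implicit.
Unset Printing Implicit Defensive.
Import Order.TTheory GRing.Theory Num.Theory.
Import numFieldNormedType.Exports.
Local Open Scope classical_set_scope.
Local Open Scope ring_scope.

Section model.
Variable R : realType.
Notation RT := (measurableTypeR R).

(* A probability measure on [-a, a] is represented by its extension to the
   Borel sets of R, i.e., by a probability measure on R carried by [-a, a]. *)
Definition carried (a : R) (g : probability RT R) : Prop :=
  g `[- a, a]%classic = 1%E.

Definition laplace_pdf (b z : R) : R := (2 * b)^-1 * expR (- `|z| / b).

Definition mixture_pdf (a b : R) (g : probability RT R) (x : R) : R :=
  \int[g]_(t in `[- a, a]%classic) laplace_pdf b (x - t).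

(* The sample X_1, ..., X_n is x 0, ..., x n.-1. *)
Definition loglik (a b : R) (n : nat) (x : nat -> R) (g : probability RT R) : R :=
  \sum_(i < n) ln (mixture_pdf a b g (x i)).

Definition is_npmle (a b : R) (n : nat) (x : nat -> R) (g : probability RT R) : Prop :=
  carried a g /\
  forall h : probability RT R, carried a h -> loglik a b n x h <= loglik a b n x g.

Definition coupling (g h : probability RT R) (pi : probability (RT * RT)%type R) : Prop :=
  forall B : set RT, measurable B ->
    pi (B `*` setT) = g B /\ pi (setT `*` B) = h B.

Definition wasserstein1 (g h : probability RT R) : \bar R :=
  ereal_inf [set (\int[pi]_z (`|z.1 - z.2|)%:E)%E | pi in coupling g h].

Definition rate (a b : R) (n : nat) : R :=
  (1 + a / b) `^ (1 / 4) * expR (a / (2 * b)) * n%:R `^ (- (3 / 8)).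

End model.

Section stochastic.
Context d (Omega : measurableType d) (R : realType) (P : probability Omega R).

Definition independent_seq (X : nat -> {RV P >-> measurableTypeR R}) : Prop :=
  forall (s : seq nat) (B : nat -> set (measurableTypeR R)),
    uniq s -> (forall i, measurable (B i)) ->
    P (\bigcap_(i in [set` s]) X i @^-1` B i) = (\prod_(i <- s) P (X i @^-1` B i))%E.

Definition sigma_seq (X : nat -> {RV P >-> measurableTypeR R}) : set (set Omega) :=
  <<s [set E | exists i, exists2 B : set (measurableTypeR R),
                 measurable B & E = X i @^-1` B] >>.

Definition independent_of (X Y : nat -> {RV P >-> measurableTypeR R}) : Prop :=
  forall E F : set Omega, sigma_seq X E -> sigma_seq Y F ->
    P (E `&` F) = (P E * P F)%E.

(* Y_n = O_p(r_n) as n -> oo. [mu_ext P] is the outer measure of P: it agrees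
   with P on measurable sets, and makes sense of the probability when Y n is
   not known to be measurable, as for a selection among maximizers. *)
Definition bigO_p (Y : nat -> Omega -> \bar R) (r : nat -> R) : Prop :=
  forall eps : R, 0 < eps ->
    exists2 M : R, 0 < M &
      \forall n \near \oo,
        (mu_ext P [set w | ((M * r n)%:E < `|Y n w|)%E] <= eps%:E)%E.

End stochastic.

(* Main.v *)
Require Import Defs.
From HB Require Import structures.
From mathcomp Require Import all_boot all_order all_algebra.
From mathcomp Require Import all_classical all_reals all_analysis.
From mathcomp Require Import measurable_realfun.
From mathcomp Require Import ring lra.
Set Implicit Arguments.
Unset Strict Implicit.
Unset Printing Implicit Defensive.
Import Order.TTheory GRing.Theory Num.Theory.
Import numFieldNormedType.Exports.
Local Open Scope classical_set_scope.
Local Open Scope ring_scope.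

(** Fix a maximizer [g] of the likelihood, write [m] and [m0] for the mixture
    densities of [g] and [g0], and let [L := ln m0 - ln m].  As [g0] competes
    with [g], the empirical mean of [L] is nonpositive, so the Kullback-Leibler
    divergence, which is the integral of [m0 * L], is at most the deviation
    between the empirical and the true mean of [L].  The divergence dominates
    [J], the integral of [m0 * L ^+ 2] (lemma [llr_sq_le_kl]), and the [L^1]
    distance of [m] and [m0] is at most a multiple of the square root of [J]
    (lemma [L1_le_llr_sq]).  It remains to bound the deviation by a small
    multiple of [J] plus a multiple of [n^(-3/4)], although [L] depends on the
    sample.

    The function [L] cannot vary much.  It is bounded, Lipschitz, and constant
    on both sides of [-a, a].  Moreover the Laplace density satisfies
    [f (z + e) + f (z - e) <= 2 * cosh (e / b) * f z], and this passes to
    mixtures; hence the second differences of the logarithm of a mixture with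
    step [e] are at most a multiple of [e^2] (lemma [logmix_semiconvex]).  A
    one-sided bound is enough, because the sum of the second differences
    telescopes.  So, at the nodes of a subdivision of [-a, a] in [n] cells, the
    values [L_k] have second differences of total size [O(1/n)]
    (lemma [llr_node_tv]).  Let [Q] be the sum of the [L_k^2] and [M] the
    maximum of the [|L_k|].  A summation by parts gives
    [sum (L_(k+1) - L_k)^2 = O(M / n)], and telescoping [|L|^3] gives
    [M^3 = O(Q / n)], which is [O(J)] up to lower order terms.

    Only the deviations [nu_k] of the cell frequencies remain random.  They are
    replaced by the discounted sums [S_j], the sum over [k <= j] of
    [(1 - n^(-3/4))^(j - k) * nu_k].  Pairwise independence of the observations
    shows that [n^(-3/4) * sum S_j^2 + S_(n-1)^2] has mean at most [2 / n]
    (lemma [mean_dev_energy]).  On the event where this quantity is at most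
    [T / n], an Abel summation and Young's inequality bound the sum of the
    [L_k * nu_k] by [eps * J + C * n^(-3/4)] with [C] depending on [T] and
    [eps] (lemma [linear_form_le]).  Hence [J = O(n^(-3/4))] off an event of
    probability at most [2 / T], and the [L^1] rate is [n^(-3/8)].  The event
    is measurable and the same for all maximizers, so that its probability
    bounds the outer measure of the event where [ghat] errs by more.

    For the Wasserstein distance, coupling two measures [g] and [h] by their
    quantile functions bounds it by the difference of the integrals of one
    1-Lipschitz function [phi] against [h] and [g] (lemma [wasserstein1_le]).
    To bring in the mixtures, set
    [T_s phi := 2 * cosh (s / b) * phi - phi (. + s) - phi (. - s)], a finite
    difference version of the operator [1 - b^2 D^2] which inverts the
    convolution with the Laplace density.  Convolving [T_s phi] with the
    Laplace density averages [phi] over a window of width [s], up to the factor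
    [2 * cosh (s / b) - 2].  It follows that the distance is at most
    [2 * s + (2 * a + 8 * b^2 / s) * delta], with [delta] the [L^1] distance of
    the mixtures (lemma [wasserstein1_le_L1]).  Taking [s] to be the square
    root of the rate gives an error [O(r_n + sqrt r_n)], which is smaller than
    the rate of the theorem by a logarithmic factor; the other forms of the
    rate are compared with this one. *)

(** * Linear forms in a slowly varying sequence *)

Section discrete.
Variable R : realType.
Implicit Types (L S nu : nat -> R).

Lemma young_mul (t x y : R) : 0 < t -> x * y <= t * x ^+ 2 + y ^+ 2 / (4 * t).
Proof.
move=> t0; rewrite -subr_ge0.
have -> : t * x ^+ 2 + y ^+ 2 / (4 * t) - x * y =
    (2 * t * x - y) ^+ 2 / (4 * t) by field; lra.
by rewrite divr_ge0 ?sqr_ge0 //; lra.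
Qed.

(** Abel summation for a discounted sum: when [S j = r * S (j - 1) + nu j], the
    left-hand side is the sum of the [L k * nu k]. *)
Lemma summation_by_parts L S (r : R) p :
  \sum_(k < p.+1) L k * (S k - r * (if (k : nat) is j.+1 then S j else 0)) =
  \sum_(j < p) (L j - r * L j.+1) * S j + L p * S p.
Proof.
elim: p => [|p IH]; first by rewrite big_ord_recl !big_ord0 /=; ring.
rewrite big_ord_recr IH [X in _ = X + _]big_ord_recr /=; ring.
Qed.

Lemma sum_sqr_diff L p :
  \sum_(j < p.+1) (L j.+1 - L j) ^+ 2 =
  L p.+1 * (L p.+1 - L p) - L 0%N * (L 1%N - L 0%N)
  - \sum_(j < p) L j.+1 * (L j.+2 - 2 * L j.+1 + L j).
Proof.
elim: p => [|p IH]; first by rewrite big_ord_recl !big_ord0 /=; ring.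
rewrite big_ord_recr IH [X in _ = _ - X]big_ord_recr /=; ring.
Qed.

(** A sequence whose slope has small total variation oscillates little in the
    quadratic sense: summing by parts moves one difference onto the other, where
    it becomes a second difference. *)
Lemma sum_sqr_diff_le L (A M : R) p :
  (forall k, (k <= p)%N -> `|L k| <= M) ->
  (forall k, (k < p)%N -> `|L k.+1 - L k| <= A) ->
  \sum_(j < p.-1) `|L j.+2 - 2 * L j.+1 + L j| <= A ->
  \sum_(j < p) (L j.+1 - L j) ^+ 2 <= 3 * A * M.
Proof.
case: p => [|p] LM LA L2.
  rewrite big_ord0; move: L2; rewrite big_ord0 => A0.
  by rewrite !mulr_ge0//; apply: le_trans (LM 0%N _).
rewrite sum_sqr_diff.
have M0 : 0 <= M by apply: le_trans (LM 0%N _).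
have A0 : 0 <= A by apply: le_trans (LA 0%N _).
have h1 : L p.+1 * (L p.+1 - L p) <= M * A.
  apply: le_trans (ler_norm _) _; rewrite normrM.
  by apply: ler_pM => //; [exact: LM|exact: LA].
have h2 : - (L 0%N * (L 1%N - L 0%N)) <= M * A.
  apply: le_trans (ler_norm _) _; rewrite normrN normrM.
  by apply: ler_pM => //; [exact: LM|exact: LA].
have h3 : - (\sum_(j < p) L j.+1 * (L j.+2 - 2 * L j.+1 + L j)) <= M * A.
  apply: le_trans (ler_norm _) _; rewrite normrN.
  apply: le_trans (ler_norm_sum _ _ _) _.
  apply: le_trans (_ : M * \sum_(j < p) `|L j.+2 - 2 * L j.+1 + L j| <= _); last first.
    exact: ler_wpM2l.
  rewrite mulr_sumr; apply: ler_sum => j _; rewrite normrM.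
  by apply: ler_wpM2r => //; apply: LM; rewrite ltnS ltnW.
lra.
Qed.

Lemma cube_diff_le (x y : R) :
  `| `|x| ^+ 3 - `|y| ^+ 3 | <= 3 / 2 * `|x - y| * (x ^+ 2 + y ^+ 2).
Proof.
rewrite -(real_normK (num_real x)) -(real_normK (num_real y)).
have d := ler_dist_dist x y.
move: (normr_ge0 x) (normr_ge0 y) d; move: `|x| `|y| => u v u0 v0 d.
have -> : u ^+ 3 - v ^+ 3 = (u - v) * (u ^+ 2 + u * v + v ^+ 2) by ring.
rewrite normrM [X in _ * X]ger0_norm ?addr_ge0 ?mulr_ge0//.
rewrite [X in _ <= X](_ : _ = `|x - y| * (3 / 2 * (u ^+ 2 + v ^+ 2))); last by ring.
apply: ler_pM => //; first by rewrite !addr_ge0// ?mulr_ge0.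
have := sqr_ge0 (u - v); nra.
Qed.

Lemma dist_le_sum_step (f : nat -> R) p i j : (i <= p)%N -> (j <= p)%N ->
  `|f j - f i| <= \sum_(k < p) `|f k.+1 - f k|.
Proof.
wlog ij : i j / (i <= j)%N => [W ip jp|ip jp].
  by have [/W->//|/ltnW/W] := leqP i j; rewrite distrC; apply.
rewrite -(telescope_sumr f ij); apply: le_trans (ler_norm_sum _ _ _) _.
rewrite -(big_mkord xpredT (fun k => `|f k.+1 - f k|)).
rewrite (@big_cat_nat _ _ _ i _ p)//= (@big_cat_nat _ _ _ j i p)//=.
rewrite addrCA lerDl addr_ge0 //; exact: sumr_ge0.
Qed.

(** The supremum of a slowly varying sequence is controlled by its quadratic mean:
    [|L|^3] has increments at most [3/2 * A * (x^2 + y^2)], so that any two values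
    of it differ by [3 * A * Q], and averaging over the second index leaves [Q] and
    the mean of [|L|^3], at most [B * Q / n]. *)
Lemma cube_sup_le L (A B : R) p j : 0 <= A ->
  (forall k, (k <= p)%N -> `|L k| <= B) ->
  (forall k, (k < p)%N -> `|L k.+1 - L k| <= A) ->
  (j <= p)%N ->
  `|L j| ^+ 3 <= (B / p.+1%:R + 3 * A) * \sum_(k < p.+1) L k ^+ 2.
Proof.
move=> A0 LB LA jp; set Q := \sum_(k < p.+1) _.
have step i : (i <= p)%N -> `|L j| ^+ 3 <= `|L i| ^+ 3 + 3 * A * Q.
  move=> ip; rewrite -lerBlDl; apply: le_trans (ler_norm _) _.
  apply: le_trans (dist_le_sum_step (fun k => `|L k| ^+ 3) ip jp) _.
  apply: le_trans (_ : \sum_(k < p) 3 / 2 * A * (L k ^+ 2 + L k.+1 ^+ 2) <= _).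
    apply: ler_sum => k _; apply: le_trans (cube_diff_le _ _) _.
    rewrite [L k ^+ 2 + _]addrC; apply: ler_wpM2r.
      by rewrite addr_ge0 ?sqr_ge0.
    by apply: ler_wpM2l; [lra|exact: LA].
  rewrite -mulr_sumr big_split /=.
  have h1 : \sum_(k < p) L k ^+ 2 <= Q by rewrite /Q big_ord_recr /= lerDl sqr_ge0.
  have h2 : \sum_(k < p) L k.+1 ^+ 2 <= Q by rewrite /Q big_ord_recl /= lerDr sqr_ge0.
  by nra.
have cubeQ : \sum_(i < p.+1) `|L i| ^+ 3 <= B * Q.
  rewrite mulr_sumr; apply: ler_sum => i _.
  rewrite exprS real_normK ?num_real//; apply: ler_wpM2r; rewrite ?sqr_ge0//.
  by apply: LB; rewrite -ltnS.
have : \sum_(i < p.+1) `|L j| ^+ 3 <= \sum_(i < p.+1) (`|L i| ^+ 3 + 3 * A * Q).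
  by apply: ler_sum => i _; apply: step; rewrite -ltnS.
rewrite big_split /= !sumr_const card_ord -[X in X <= _]mulr_natl -[X in _ <= _ + X]mulr_natl => h.
have n0 : 0 < p.+1%:R :> R by rewrite ltr0n.
rewrite -(ler_pM2l n0); apply: le_trans h _.
rewrite [X in _ <= X](_ : _ = B * Q + p.+1%:R * (3 * A * Q)); last by field; lra.
by rewrite lerD2r.
Qed.

(** The deterministic core of the rate.  With [n = p.+1] and [h = n^(-1/4)], the
    linear form is the sum of the [L k * nu k] for the deviations [nu] that have
    the discounted sums [S].  Abel summation produces three terms, in [h^3 * L],
    in the differences of [L], and at the right end.  Young's inequality splits
    each of them in a part of size [T * h^3 / (4 * eps)] and a part in [L].  The
    latter is [eps] times the mean of [L^2] for the first term, and a multiple of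
    [eps * (M + h)^3] for the two others, the quadratic variation of [L] being
    [O(M * h^4)]; [cube_sup_le] bounds it by the mean of [L^2] and [h^3].  The
    exponent of [h] in the discount is the one that balances these terms. *)
Lemma linear_form_le L S (A B T h eps : R) p :
  0 <= A -> 0 <= B -> 0 <= T -> 0 < h -> h <= 1 -> 0 < eps ->
  p.+1%:R * h ^+ 4 = 1 ->
  (forall k, (k <= p)%N -> `|L k| <= B) ->
  (forall k, (k < p)%N -> `|L k.+1 - L k| <= A * h ^+ 4) ->
  \sum_(j < p.-1) `|L j.+2 - 2 * L j.+1 + L j| <= A * h ^+ 4 ->
  h ^+ 3 * \sum_(j < p.+1) S j ^+ 2 + S p ^+ 2 <= T * h ^+ 4 ->
  `| \sum_(k < p.+1)
      L k * (S k - (1 - h ^+ 3) * (if (k : nat) is j.+1 then S j else 0)) | <=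
  eps * (1 + 4 * (3 * A + 1) * (B + 3 * A)) *
    (h ^+ 4 * \sum_(k < p.+1) L k ^+ 2) +
  (3 * T / (4 * eps) + 4 * (3 * A + 1) * eps) * h ^+ 3.
Proof.
move=> A0 B0 T0 h0 h1 e0 nh LB LA L2 ST.
have h4 : h ^+ 4 = p.+1%:R^-1.
  by apply: (@mulfI _ p.+1%:R); rewrite ?pnatr_eq0 // nh divff // pnatr_eq0.
have h40 : 0 < h ^+ 4 by rewrite exprn_gt0.
have h30 : 0 < h ^+ 3 by rewrite exprn_gt0.
have h31 : h ^+ 3 <= 1 by rewrite exprn_ile1// ltW.
set Q := \sum_(k < p.+1) L k ^+ 2; set SS := \sum_(j < p.+1) S j ^+ 2 in ST.
have Q0 : 0 <= Q by apply: sumr_ge0 => k _; exact: sqr_ge0.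
have SS0 : 0 <= SS by apply: sumr_ge0 => k _; exact: sqr_ge0.
have SSp : \sum_(j < p) S j ^+ 2 <= SS.
  by rewrite /SS big_ord_recr /= lerDl sqr_ge0.
have Qp : \sum_(j < p) L j ^+ 2 <= Q.
  by rewrite /Q big_ord_recr /= lerDl sqr_ge0.
have SSle : SS <= T * h.
  rewrite -(ler_pM2l h30); have := sqr_ge0 (S p).
  rewrite [X in _ -> _ <= X](_ : _ = T * h ^+ 4); last by ring.
  lra.
have Sple : S p ^+ 2 <= T * h ^+ 4 by have := mulr_ge0 (ltW h30) SS0; lra.
(* [M] is the maximum of the [|L k|], bounded by the quadratic mean of [L]. *)
have [M [M0 LM M3]] : exists M : R, [/\ 0 <= M, forall k, (k <= p)%N -> `|L k| <= M
    & M ^+ 3 <= (B + 3 * A) * (h ^+ 4 * Q)].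
  have [i _ iP] := @arg_maxP _ _ 'I_p.+1 ord0 xpredT (fun k => `|L k|) isT.
  exists `|L i|; split=> // [k kp|].
    by have := iP (inord k) isT; rewrite inordK.
  have ip : (i <= p)%N by rewrite -ltnS.
  have := @cube_sup_le L (A * h ^+ 4) B p i (mulr_ge0 A0 (ltW h40)) LB LA ip.
  rewrite -h4 -/Q => H; apply: le_trans H _.
  by rewrite le_eqVlt; apply/orP; left; apply/eqP; ring.
have D : \sum_(j < p) (L j.+1 - L j) ^+ 2 <= 3 * (A * h ^+ 4) * M.
  exact: sum_sqr_diff_le.
(* [h] is added so that the weights of Young's inequality do not degenerate
   when [L] is small. *)
set m := M + h; have m0 : 0 < m by rewrite ltr_wpDl.
have hm : h <= m by rewrite /m; lra.
have Mm : M <= m by rewrite /m; lra.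
have m3 : m ^+ 3 <= 4 * (M ^+ 3 + h ^+ 3).
  rewrite /m -subr_ge0.
  have -> : 4 * (M ^+ 3 + h ^+ 3) - (M + h) ^+ 3 = 3 * ((M + h) * (M - h) ^+ 2) by ring.
  by rewrite mulr_ge0// mulr_ge0 ?sqr_ge0// addr_ge0// ltW.
rewrite summation_by_parts.
have b1 : \sum_(j < p) `|h ^+ 3 * L j * S j| <=
    eps * (h ^+ 4 * Q) + T * h ^+ 3 / (4 * eps).
  apply: le_trans (_ : \sum_(j < p) (eps * h ^+ 4 * L j ^+ 2 +
                                h ^+ 2 / (4 * eps) * S j ^+ 2) <= _).
    apply: ler_sum => j _.
    have := @young_mul eps (h ^+ 2 * `|L j|) (h * `|S j|) e0.
    rewrite [X in X <= _ -> _](_ : _ = `|h ^+ 3 * L j * S j|); last first.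
      by rewrite normrM normrM (ger0_norm (ltW h30)); ring.
    move=> H; apply: le_trans H _; rewrite !exprMn !real_normK ?num_real//.
    by rewrite le_eqVlt; apply/orP; left; apply/eqP; field; rewrite gt_eqF.
  rewrite big_split /= -!mulr_sumr lerD//.
    by rewrite -mulrA ler_wpM2l ?(ltW e0)// ler_wpM2l// ltW.
  apply: le_trans (_ : h ^+ 2 / (4 * eps) * (T * h) <= _).
    rewrite ler_wpM2l//; first by rewrite divr_ge0 ?sqr_ge0//; lra.
    exact: le_trans SSp SSle.
  by rewrite le_eqVlt; apply/orP; left; apply/eqP; field; lra.
have b2 : \sum_(j < p) `|(L j.+1 - L j) * S j| <=
    3 * A * eps * m ^+ 3 + T * h ^+ 3 / (4 * eps).
  (* this weight turns the quadratic variation, at most [3 * A * h^4 * M], into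
     [3 * A * eps * m^3] *)
  set t := eps * m ^+ 2 / h ^+ 4.
  have t0 : 0 < t by rewrite /t divr_gt0// mulr_gt0// exprn_gt0.
  apply: le_trans (_ : \sum_(j < p) (t * (L j.+1 - L j) ^+ 2 +
                                (4 * t)^-1 * S j ^+ 2) <= _).
    apply: ler_sum => j _; rewrite normrM.
    have := @young_mul t (`|L j.+1 - L j|) (`|S j|) t0.
    by rewrite !real_normK ?num_real// [_ / (4 * t)]mulrC.
  rewrite big_split /= -!mulr_sumr lerD//.
    apply: le_trans (ler_wpM2l (ltW t0) D) _.
    rewrite [X in X <= _](_ : _ = 3 * A * eps * (m ^+ 2 * M)); last first.
      by rewrite /t; field; lra.
    by rewrite [m ^+ 3]exprSr ler_wpM2l ?mulr_ge0 ?(ltW e0)// ler_wpM2l ?sqr_ge0.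
  apply: le_trans (_ : (4 * t)^-1 * (T * h) <= _).
    rewrite ler_wpM2l//; first by rewrite invr_ge0; lra.
    exact: le_trans SSp SSle.
  rewrite [X in X <= _](_ : _ = T * h ^+ 3 / (4 * eps) * (h ^+ 2 / m ^+ 2)); last first.
    by rewrite /t; field; rewrite !gt_eqF//; lra.
  rewrite -[X in _ <= X]mulr1 ler_wpM2l//.
    by rewrite divr_ge0// mulr_ge0// ltW.
  by rewrite ler_pdivrMr ?exprn_gt0// mul1r lerXn2r ?nnegrE// ltW.
have b3 : `|L p * S p| <= eps * m ^+ 3 + T * h ^+ 3 / (4 * eps).
  have em0 : 0 < eps * m by rewrite mulr_gt0.
  have H := @young_mul (eps * m) m `|S p| em0.
  rewrite real_normK ?num_real// in H.
  rewrite normrM; apply: le_trans (ler_wpM2r (normr_ge0 _) (le_trans (LM p (leqnn p)) Mm)) _.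
  apply: le_trans H _; rewrite -mulrA -exprS lerD2l.
  rewrite ler_pdivrMr; last lra.
  apply: le_trans Sple _.
  rewrite [X in _ <= X](_ : _ = T * h ^+ 3 * m); last by field; lra.
  by rewrite exprSr mulrA ler_wpM2l// mulr_ge0// ltW.
have b0 : `|\sum_(j < p) (L j - (1 - h ^+ 3) * L j.+1) * S j| <=
    \sum_(j < p) `|h ^+ 3 * L j * S j| + \sum_(j < p) `|(L j.+1 - L j) * S j|.
  apply: le_trans (ler_norm_sum _ _ _) _; rewrite -big_split /=.
  apply: ler_sum => j _.
  rewrite [X in `|X|](_ : _ = h ^+ 3 * L j * S j -
     (1 - h ^+ 3) * ((L j.+1 - L j) * S j)); last by ring.
  apply: le_trans (ler_normB _ _) _; rewrite lerD2l normrM.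
  rewrite ger0_norm ?subr_ge0//.
  by rewrite -[X in _ <= X]mul1r ler_wpM2r// gerBl ltW.
apply: le_trans (ler_normD _ _) _.
have m3' : m ^+ 3 <= 4 * ((B + 3 * A) * (h ^+ 4 * Q) + h ^+ 3).
  by apply: le_trans m3 _; rewrite ler_wpM2l// lerD2r.
have m3'' := ler_wpM2l (_ : 0 <= (3 * A + 1) * eps) m3'.
have {}m3'' := m3'' (mulr_ge0 (addr_ge0 (mulr_ge0 (ler0n _ 3) A0) ler01) (ltW e0)).
set t := T * h ^+ 3 / (4 * eps) in b1 b2 b3 *.
rewrite [X in _ <= X](_ : _ = eps * (h ^+ 4 * Q) + 3 * t +
   (3 * A + 1) * eps * (4 * ((B + 3 * A) * (h ^+ 4 * Q) + h ^+ 3))); last first.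
  by rewrite /t; field; rewrite gt_eqF.
move: b0 b1 b2 b3 m3''; clear; lra.
Qed.
End discrete.

(** * Laplace mixtures and their logarithms *)

Section laplace.
Context {R : realType} (b : R) (b0 : 0 < b).
Implicit Types x y z e : R.

Lemma laplace_gt0 z : 0 < laplace_pdf b z.
Proof. by rewrite mulr_gt0 ?expR_gt0// invr_gt0 mulr_gt0. Qed.

Lemma laplace_lip x y : laplace_pdf b x <= expR (`|x - y| / b) * laplace_pdf b y.
Proof.
rewrite /laplace_pdf mulrCA ler_wpM2l ?invr_ge0 ?mulr_ge0 ?(ltW b0)//.
rewrite -expRD ler_expR -mulrDl ler_wpM2r ?invr_ge0 ?(ltW b0)//.
by have := ler_distD x y 0; rewrite !subr0 distrC; lra.
Qed.

Lemma laplace_le z : laplace_pdf b z <= (2 * b)^-1.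
Proof.
rewrite /laplace_pdf ler_piMr ?invr_ge0 ?mulr_ge0 ?(ltW b0)//.
by rewrite expR_le1 mulNr oppr_le0 divr_ge0// ltW.
Qed.

Lemma laplaceN z : laplace_pdf b (- z) = laplace_pdf b z.
Proof. by rewrite /laplace_pdf normrN. Qed.

(** For [z >= 0], [z + e] has norm [z + e] and [z - e] has norm at least
    [z - e]; equality holds as soon as [e <= |z|]. *)
Lemma laplace_semiconvex z e : 0 <= e ->
  laplace_pdf b (z + e) + laplace_pdf b (z - e) <=
  (expR (e / b) + expR (- (e / b))) * laplace_pdf b z.
Proof.
move=> e0; wlog z0 : z / 0 <= z => [W|].
  have [/W//|z0] := leP 0 z.
  have -> : z + e = - (- z - e) by ring.
  have -> : z - e = - (- z + e) by ring.
  rewrite !laplaceN addrC -[laplace_pdf b z]laplaceN; apply: W; lra.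
rewrite /laplace_pdf -mulrDr mulrCA ler_wpM2l ?invr_ge0 ?mulr_ge0 ?(ltW b0)//.
rewrite mulrDl addrC lerD// -expRD ler_expR -?mulNr -mulrDl ler_wpM2r ?invr_ge0 ?(ltW b0)//.
- by rewrite (ger0_norm z0); have := ler_norm (z - e); lra.
- by rewrite !ger0_norm; lra.
Qed.

Lemma laplace_continuous : continuous (laplace_pdf b).
Proof.
move=> x; apply: cvgMr; apply: continuous_comp; last exact: continuous_expR.
by apply: cvgMl; apply: cvgN; exact: norm_continuous.
Qed.

Lemma measurable_laplace : measurable_fun [set: R] (laplace_pdf b).
Proof. by apply: continuous_measurable_fun; exact: laplace_continuous. Qed.

Lemma measurable_laplace_shift d (T : measurableType d) (f : T -> R) :
  measurable_fun [set: T] f -> measurable_fun [set: T] (fun t => laplace_pdf b (f t)).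
Proof. by move=> mf; apply: measurableT_comp => //; exact: measurable_laplace. Qed.

End laplace.

Section cosh.
Context {R : realType}.

Lemma ln_sub_le (u v d : R) : 0 < u -> 0 < v -> u <= expR d * v -> ln u - ln v <= d.
Proof.
move=> u0 v0 uv; rewrite lerBlDr -[d]expRK -lnM ?posrE ?expR_gt0//.
by rewrite ler_ln ?posrE// mulr_gt0// expR_gt0.
Qed.

(** A quadratic bound is all that the second differences of [logmix] require, and
    only for small steps, large ones being covered by the Lipschitz bound. *)
Lemma cosh_le (y : R) : 0 <= y -> y <= 1 / 3 ->
  (expR y + expR (- y)) / 2 <= 1 + y ^+ 2.
Proof.
move=> y0 y3.
have h1 : expR (- y) <= 1 - y + y ^+ 2.
  rewrite expRN -[X in X <= _]mul1r ler_pdivrMr ?expR_gt0//.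
  apply: le_trans (_ : (1 - y + y ^+ 2) * (1 + y) <= _); first by nra.
  by rewrite ler_wpM2l ?expR_ge1Dx//; nra.
have h2 : expR y <= 1 + y + y ^+ 2.
  have h5 : (1 - y / 2) ^+ 2 <= expR (- y).
    have -> : expR (- y) = expR (- y / 2) ^+ 2.
      by rewrite -expRM_natl; congr expR; field.
    have := expR_ge1Dx (- y / 2); move: (expR _) => E H.
    by nra.
  rewrite -[y in expR y]opprK expRN -[X in X <= _]mul1r ler_pdivrMr ?expR_gt0//.
  apply: le_trans (_ : (1 + y + y ^+ 2) * (1 - y / 2) ^+ 2 <= _).
    have := mulr_ge0 (mulr_ge0 y0 y0) (_ : 0 <= 1 - 3 * y + y ^+ 2); nra.
  by rewrite ler_wpM2l//; nra.
by move: h1 h2; move: (expR _) (expR _) => E F; lra.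
Qed.
End cosh.

Section mixture.
Context {R : realType} (a b : R) (a0 : 0 < a) (b0 : 0 < b).
Notation RT := (measurableTypeR R).
Notation D := (`[- a, a]%classic : set RT).
Implicit Types (g h : probability RT R) (x y z e s t c C : R).

Lemma measurable_D : measurable D.
Proof. exact: measurable_itv. Qed.

Lemma bounded_integrable d (T : measurableType d) (P : probability T R) (A : set T)
    (f : T -> R) C :
  measurable A -> measurable_fun A f -> (forall w, A w -> `|f w| <= C) ->
  P.-integrable A (EFin \o f).
Proof.
move=> mA mf fC; apply: measurable_bounded_integrable => //.
  by rewrite (le_lt_trans (probability_le1 P mA))// ltry.
exists C; split; first exact: num_real.
by move=> M CM x Ax; apply: le_trans (fC x Ax) (ltW CM).
Qed.

Lemma kernel_integrable g x : g.-integrable D (EFin \o (fun t => laplace_pdf b (x - t))).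
Proof.
apply: (@bounded_integrable _ _ _ _ _ (2 * b)^-1).
- exact: measurable_D.
- apply/measurable_funTS/measurable_laplace_shift => //.
  exact: measurable_funB.
- by move=> t _; rewrite ger0_norm ?laplace_le// ltW// laplace_gt0.
Qed.

Lemma mixture_le g c x y : carried a g ->
  (forall t, - a <= t <= a -> laplace_pdf b (x - t) <= c * laplace_pdf b (y - t)) ->
  mixture_pdf a b g x <= c * mixture_pdf a b g y.
Proof.
move=> cg H; rewrite /mixture_pdf -RintegralZl; [|exact: measurable_D|exact: kernel_integrable].
apply: le_Rintegral; [exact: measurable_D|exact: kernel_integrable| |].
  exact: (integrableZl measurable_D c (kernel_integrable g y)).
by move=> t /=; rewrite in_itv /= => /H.
Qed.

Lemma mixture_add_le g c x1 x2 y : carried a g ->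
  (forall t, laplace_pdf b (x1 - t) + laplace_pdf b (x2 - t) <= c * laplace_pdf b (y - t)) ->
  mixture_pdf a b g x1 + mixture_pdf a b g x2 <= c * mixture_pdf a b g y.
Proof.
move=> cg H; rewrite /mixture_pdf -RintegralZl; [|exact: measurable_D|exact: kernel_integrable].
rewrite -RintegralD; [|exact: measurable_D|exact: kernel_integrable|exact: kernel_integrable].
apply: le_Rintegral; [exact: measurable_D| | |by move=> t _; exact: H].
- exact: (integrableD measurable_D (kernel_integrable g x1) (kernel_integrable g x2)).
- exact: (integrableZl measurable_D c (kernel_integrable g y)).
Qed.

Lemma mixture_bounds g x c C : carried a g ->
  (forall t, - a <= t <= a -> c <= laplace_pdf b (x - t) <= C) ->
  c <= mixture_pdf a b g x <= C.
Proof.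
move=> cg H.
have cst r : \int[g]_(t in D) r = r.
  rewrite Rintegral_cst; last exact: measurable_D.
  by rewrite -[RHS]mulr1; congr (_ * _); exact: (congr1 fine cg).
have ic r : g.-integrable D (EFin \o (fun=> r)).
  apply: (@bounded_integrable _ _ _ _ _ `|r|) => //; exact: measurable_D.
rewrite -{1}(cst c) -(cst C) /mixture_pdf; apply/andP; split;
  apply: le_Rintegral; try exact: measurable_D; try exact: kernel_integrable; try exact: ic;
  by move=> t /=; rewrite in_itv /= => /H /andP[].
Qed.

(** The range of the log-likelihood ratio of two mixtures: both densities lie
    within a factor [exp (a / b)] of the Laplace density. *)
Definition llr_range : R := 2 * a / b.

Lemma llr_range_gt0 : 0 < llr_range. Proof. by rewrite divr_gt0// mulr_gt0. Qed.

Lemma mixture_sandwich g x : carried a g ->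
  expR (- (a / b)) * laplace_pdf b x <= mixture_pdf a b g x <= expR (a / b) * laplace_pdf b x.
Proof.
move=> cg; apply: mixture_bounds => // t /andP[ta at_].
have h : `|t| / b <= a / b by rewrite ler_pM2r ?invr_gt0// ler_norml ta.
apply/andP; split.
  have := laplace_lip b0 x (x - t); rewrite opprB addrC subrK => H.
  rewrite -(ler_pM2l (expR_gt0 (a / b))) mulrA -expRD subrr expR0 mul1r.
  apply: le_trans H _; rewrite ler_wpM2r ?ler_expR//.
  exact/ltW/laplace_gt0.
have := laplace_lip b0 (x - t) x; rewrite addrAC subrr add0r normrN => H.
apply: le_trans H _; rewrite ler_wpM2r ?ler_expR//.
exact/ltW/laplace_gt0.
Qed.

Lemma mixture_gt0 g x : carried a g -> 0 < mixture_pdf a b g x.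
Proof.
move=> /(mixture_sandwich x)/andP[h _]; apply: lt_le_trans h.
by rewrite mulr_gt0 ?expR_gt0// laplace_gt0.
Qed.

Definition logmix g x : R := ln (mixture_pdf a b g x).

Lemma mixtureE g x : carried a g -> mixture_pdf a b g x = expR (logmix g x).
Proof. by move=> cg; rewrite lnK// posrE mixture_gt0. Qed.

Lemma logmix_lip g x y : carried a g -> `|logmix g x - logmix g y| <= `|x - y| / b.
Proof.
move=> cg; wlog xy : x y / logmix g y <= logmix g x => [W|].
  have [/W//|/ltW yx] := leP (logmix g y) (logmix g x).
  by rewrite distrC [`|x - y|]distrC; exact: W.
rewrite ger0_norm ?subr_ge0//; apply: ln_sub_le; [exact: mixture_gt0..|].
apply: mixture_le => // t _.
have := laplace_lip b0 (x - t) (y - t).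
by rewrite (_ : x - t - (y - t) = x - y)//; ring.
Qed.

(** Beyond [a], on the side given by the sign [s], the kernels of all centres in [-a, a]
    decay by the same exponential factor, so that the logarithm is affine with a slope that
    does not depend on [g]. *)
Lemma logmix_tail g x y s : carried a g -> `|s| = 1 -> a <= s * x -> a <= s * y ->
  logmix g x - logmix g y = (s * y - s * x) / b.
Proof.
move=> cg s1.
wlog suff W : x y / a <= s * x -> a <= s * y ->
    logmix g x - logmix g y <= (s * y - s * x) / b.
  move=> sx sy; apply/eqP; rewrite eq_le W//=.
  by rewrite -lerN2 opprB -mulNr opprB; exact: W.
move=> sx sy.
apply: ln_sub_le; [exact: mixture_gt0..|].
apply: mixture_le => // t /andP[ta at_].
rewrite /laplace_pdf mulrCA ler_wpM2l ?invr_ge0 ?mulr_ge0 ?(ltW b0)//.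
rewrite -expRD ler_expR -mulrDl ler_wpM2r ?invr_ge0 ?(ltW b0)//.
have nE z : a <= s * z -> `|z - t| = s * z - s * t.
  move=> sz; rewrite -[LHS]mul1r -s1 -normrM mulrBr ger0_norm// subr_ge0.
  apply: le_trans sz; apply: le_trans (ler_norm _) _.
  by rewrite normrM s1 mul1r ler_norml ta.
by rewrite !nE//; lra.
Qed.

(** Laplace mixtures inherit [laplace_semiconvex] by linearity, and the
    arithmetic-geometric mean inequality turns the bound on [m (x + e) + m (x - e)]
    into one on the product, that is on the sum of the logarithms. *)
Lemma logmix_semiconvex g x e : carried a g -> 0 <= e ->
  logmix g (x + e) - 2 * logmix g x + logmix g (x - e) <= 6 * (e / b) ^+ 2.
Proof.
move=> cg e0; set y := e / b.
have y0 : 0 <= y by rewrite divr_ge0// ltW.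
have [y3|y3] := leP (1 / 3) y.
  have h1 := le_trans (ler_norm _) (logmix_lip (x + e) x cg).
  have h2 := le_trans (ler_norm _) (logmix_lip (x - e) x cg).
  move: h1 h2; rewrite [x + e]addrC addrK [x - e]addrC addrK normrN (ger0_norm e0) -/y.
  have : y <= 3 * y ^+ 2 by move: y3 y0; clear; nra.
  move: (logmix g _) (logmix g _) (logmix g _) => u v w; clear; lra.
set m := mixture_pdf a b g; set c := (expR y + expR (- y)) / 2.
have c0 : 0 < c by rewrite divr_gt0// addr_gt0 ?expR_gt0.
have m0 z : 0 < m z by exact: mixture_gt0.
have mc : m (x + e) + m (x - e) <= 2 * c * m x.
  rewrite [2 * c](_ : _ = expR y + expR (- y)); last by rewrite /c; field.
  apply: mixture_add_le => // t; have := laplace_semiconvex b0 (x - t) e0.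
  by rewrite -/y (_ : x - t + e = x + e - t) 1?(_ : x - t - e = x - e - t)//; ring.
have mm : m (x + e) * m (x - e) <= (c * m x) ^+ 2.
  have := sqr_ge0 (m (x + e) - m (x - e)).
  have := m0 (x + e); have := m0 (x - e); have := mulr_gt0 c0 (m0 x).
  by move: mc; rewrite -mulrA; move: (m (x + e)) (m (x - e)) (c * m x) => u v w; clear; nra.
have cle : c <= 1 + y ^+ 2 by exact: cosh_le (ltW y3).
have lnc : ln c <= y ^+ 2.
  by rewrite -ler_expR lnK ?posrE//; apply: le_trans cle (expR_ge1Dx _).
have : ln (m (x + e) * m (x - e)) <= ln ((c * m x) ^+ 2).
  rewrite ler_ln ?posrE; [exact: mm|exact: mulr_gt0|exact/exprn_gt0/mulr_gt0].
rewrite (lnM (m0 _) (m0 _)) lnXn; last exact: mulr_gt0.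
rewrite (lnM c0 (m0 _)) /logmix -/m mulr2n.
have := sqr_ge0 y; move: lnc.
by move: (ln c) (ln (m x)) (ln (m (x + e))) (ln (m (x - e))) => lc u v w; clear; lra.
Qed.

End mixture.

(** * Integration of Laplace mixtures *)

Section image_measure.
Context d1 d2 (T1 : measurableType d1) (T2 : measurableType d2) (R : realType).

(** The pushforward along a function with a separate proof of measurability,
    bundled as a measure so that uniqueness theorems apply to it. *)
Definition image_measure (m : {measure set T1 -> \bar R}) (f : T1 -> T2)
    (mf : measurable_fun [set: T1] f) : {measure set T2 -> \bar R} :=
  measure_function_pushforward__canonical__measure_function_Measure m mf.

Lemma image_measureE m f mf A : @image_measure m f mf A = m (f @^-1` A).
Proof. by []. Qed.

End image_measure.

Section lebesgue_shift.
Context {R : realType}.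
Notation RT := (measurableTypeR R).
Notation mu := (@lebesgue_measure R).
Implicit Types (c x y t : R).

Lemma measurable_shift c : measurable_fun [set: RT] ((fun x => x + c) : RT -> RT).
Proof. exact: measurable_funD. Qed.

Lemma lebesgue_shift c (A : set RT) : measurable A ->
  mu ((fun x : R => x + c) @^-1` A) = mu A.
Proof.
move=> mA; pose f : RT -> RT := fun x => x + c.
have mf : measurable_fun [set: RT] f by exact: measurable_shift.
have H := @lebesgue_measure_unique R (image_measure mu mf).
symmetry; apply: (H _ A mA) => X [[u v] _ /= <-]; rewrite /image_measure /= /pushforward.
have -> : f @^-1` [set` `]u, v]] = [set` `]u - c, v - c]].
  by apply/seteqP; split => x /=; rewrite !in_itv /= /f ltrBlDr lerBrDr.
rewrite !lebesgue_measure_itv /= !lte_fin ltrD2r; case: ifP => // _.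
by rewrite -!EFinD; congr EFin; ring.
Qed.

Lemma ge0_integral_shift c (f : R -> \bar R) : measurable_fun [set: RT] f ->
  (forall x, 0 <= f x)%E ->
  (\int[mu]_x f (x + c)%R = \int[mu]_x f x)%E.
Proof.
move=> mf f0.
pose s : RT -> RT := fun x => x + c.
have ms : measurable_fun [set: RT] s by exact: measurable_shift.
rewrite -[LHS](ge0_integral_pushforward ms mu measurableT mf) //.
apply: eq_measure_integral => A mA _.
exact: lebesgue_shift.
Qed.

End lebesgue_shift.

Section laplace_mass.
Context {R : realType} (b : R) (b0 : 0 < b).
Notation mu := (@lebesgue_measure R).

Lemma integral_laplace : (\int[mu]_z (laplace_pdf b z)%:E = 1)%E.
Proof.
rewrite ge0_symfun_integralT; last 3 first.
- by move=> x; exact/ltW/laplace_gt0.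
- exact: laplace_continuous.
- by move=> x /=; rewrite laplaceN.
have := @integral_exponential_pdf R b^-1; rewrite invr_gt0 => /(_ b0) H.
rewrite -H (_ : [set x | 0 <= x] = `[0, +oo[%classic); last first.
  by apply/seteqP; split => x /=; rewrite in_itv/= andbT.
rewrite integral_mkcond [in RHS](_ : (fun x => (exponential_pdf b^-1 x)%:E) =
   ((fun x => 2%:E * (laplace_pdf b x)%:E) \_ `[0%R, +oo[)%E); last first.
  apply/funext => x; rewrite /exponential_pdf !patchE; case: ifPn => // xp.
  rewrite -EFinM; congr EFin; move: xp; rewrite inE/= in_itv/= andbT => x1.
  rewrite /laplace_pdf ger0_norm// mulrA invfM mulrA divff// mul1r.
  by rewrite !mulNr mulrC [x / b]mulrC mulrC.
rewrite -integral_mkcond -[in RHS]integral_mkcond ge0_integralZl//.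
- by apply/measurable_EFinP/measurable_funTS; exact: measurable_laplace.
- by move=> z _; rewrite lee_fin ltW ?laplace_gt0.
Qed.

End laplace_mass.

Section tonelli.
Context {R : realType} (a b : R) (a0 : 0 < a) (b0 : 0 < b).
Notation RT := (measurableTypeR R).
Notation mu := (@lebesgue_measure R).
Notation D := (`[- a, a]%classic : set RT).
Implicit Types (g h : probability RT R) (x y t : R).

Lemma mixture_full g x : carried a g ->
  ((mixture_pdf a b g x)%:E = \int[g]_t (laplace_pdf b (x - t))%:E)%E.
Proof.
move=> cg.
have iT : g.-integrable setT (EFin \o (fun t => laplace_pdf b (x - t))).
  apply: (@bounded_integrable _ _ _ _ _ _ (2 * b)^-1) => //.
    apply/measurable_laplace_shift => //; exact: measurable_funB.
  by move=> t _; rewrite ger0_norm ?laplace_le// ltW// laplace_gt0.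
rewrite (@negligible_integral _ _ _ g setT (~` D)) //; last 2 first.
- by apply: measurableC; exact: measurable_D.
- have := @probability_setC _ _ _ g D (measurable_D a).
  by rewrite (cg : g D = 1%E) subee.
rewrite setTD setCK /mixture_pdf /Rintegral fineK//.
by apply: integrable_fin_num; [exact: measurable_D|exact: kernel_integrable].
Qed.

Lemma measurable_mixture g : carried a g -> measurable_fun [set: R] (mixture_pdf a b g).
Proof.
move=> cg.
have -> : mixture_pdf a b g = (fun x => expR (logmix a b g x)).
  by apply/funext => x; rewrite -mixtureE.
apply: measurableT_comp; first exact: measurable_expR.
apply: continuous_measurable_fun => x0.
move: x0 => x; rewrite /continuous_at.
apply/cvgrPdist_le => e e0; near=> y.
rewrite /=; apply: (@le_trans _ _ (`|x - y| / b)); first exact: logmix_lip.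
rewrite ler_pdivrMr//; near: y.
exact: (@cvgr_dist_le _ _ _ _ _ id x (@cvg_id _ _) (e * b) (mulr_gt0 e0 b0)).
Unshelve. all: by end_near. Qed.

Lemma mixture_tonelli g (k : R -> R) : carried a g -> measurable_fun [set: R] k ->
  (forall y, 0 <= k y) ->
  (\int[mu]_y (k y * mixture_pdf a b g y)%:E =
   \int[g]_t \int[mu]_y (k y * laplace_pdf b (y - t))%:E)%E.
Proof.
move=> cg mk k0.
pose f := fun z : RT * RT => (k z.1 * laplace_pdf b (z.1 - z.2))%:E.
have mf : measurable_fun setT f.
  apply/measurable_EFinP; apply: measurable_funM.
    by apply: measurableT_comp => //; exact: measurable_fst.
  by apply/measurable_laplace_shift => //; apply: measurable_funB.
have f0 z : (0 <= f z)%E by rewrite lee_fin mulr_ge0// ltW// laplace_gt0.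
rewrite -(@fubini_tonelli _ _ _ _ _ mu g f mf f0).
apply: eq_integral => y _; rewrite EFinM mixture_full//.
rewrite -[LHS]ge0_integralZl//.
- by apply/measurable_EFinP/measurable_laplace_shift => //; exact: measurable_funB.
- by move=> t _; rewrite lee_fin ltW// laplace_gt0.
- by rewrite lee_fin.
Qed.

Lemma integral_mixture g : carried a g -> (\int[mu]_y (mixture_pdf a b g y)%:E = 1)%E.
Proof.
move=> cg.
have := @mixture_tonelli g (fun=> 1) cg (@measurable_cst _ _ _ _ _ _) (fun=> ler01).
under eq_integral do rewrite mul1r.
move=> ->.
under eq_integral.
  move=> t _; under eq_integral do rewrite mul1r.
  rewrite (ge0_integral_shift (- t) (f := fun z => (laplace_pdf b z)%:E)); last 2 first.
  - apply/measurable_EFinP; exact: measurable_laplace.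
  - by move=> z; rewrite lee_fin ltW// laplace_gt0.
  rewrite integral_laplace//.
  over.
rewrite integral_cst// mul1e; exact: probability_setT.
Qed.

End tonelli.

(** * The log-likelihood ratio on a grid *)

(* Arithmetic tactics are meant to treat values of mixtures as atoms. *)
Opaque mixture_pdf logmix.

Section second_difference.
Context {R : realType}.
Implicit Types (u : nat -> R) (c d : R).

(** A one-sided bound on the second differences controls their absolute values,
    because their sum telescopes to a difference of two slopes. *)
Lemma sum_second_diff_le u c d q : 0 <= c ->
  `|u 1%N - u 0%N| <= d -> `|u q.+1 - u q| <= d ->
  (forall k, (k < q)%N -> u k.+2 - 2 * u k.+1 + u k <= c) ->
  \sum_(j < q) `|u j.+2 - 2 * u j.+1 + u j| <= 2 * c * q%:R + 2 * d.
Proof.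
move=> c0 d0 dq uc.
have E : \sum_(j < q) (u j.+2 - 2 * u j.+1 + u j) = (u q.+1 - u q) - (u 1%N - u 0%N).
  rewrite -(telescope_sumr (fun j => u j.+1 - u j) (leq0n q)) big_mkord.
  by apply: eq_bigr => j _; ring.
apply: le_trans (_ : \sum_(j < q) (2 * c - (u j.+2 - 2 * u j.+1 + u j)) <= _).
  apply: ler_sum => j _; have := uc j (ltn_ord j).
  by move: (_ + u j) => x xc; rewrite ler_norml; apply/andP; split; lra.
rewrite big_split /= sumrN E sumr_const card_ord -[_ *+ q]mulr_natr.
move: d0 dq; rewrite !ler_norml => /andP[? ?] /andP[? ?]; lra.
Qed.

End second_difference.

Section llr.
Context {R : realType} (a b : R) (a0 : 0 < a) (b0 : 0 < b).
Notation RT := (measurableTypeR R).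
Notation mu := (@lebesgue_measure R).
Variables (g0 g : probability RT R).
Hypotheses (cg0 : carried a g0) (cg : carried a g).
Implicit Types (x y s : R).
Notation llr_range := (llr_range a b).

Definition llr x : R := logmix a b g0 x - logmix a b g x.

Lemma llr_bound x : `|llr x| <= llr_range.
Proof.
have W (p q : probability RT R) : carried a p -> carried a q ->
    logmix a b p x - logmix a b q x <= llr_range.
  move=> cp cq; apply: ln_sub_le; [exact: mixture_gt0..|].
  have /andP[_ h1] := mixture_sandwich b0 x cp.
  have /andP[h2 _] := mixture_sandwich b0 x cq.
  apply: le_trans h1 _.
  have -> : llr_range = a / b + a / b by rewrite /llr_range; field; rewrite gt_eqF.
  rewrite expRD -mulrA ler_wpM2l ?expR_ge0//.
  by rewrite -(ler_pM2l (expR_gt0 (- (a / b)))) [X in _ <= X]mulrA -expRD addNr expR0 mul1r.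
by rewrite ler_norml /llr W// andbT lerNl opprB W.
Qed.

Lemma llr_lip x y : `|llr x - llr y| <= 2 * `|x - y| / b.
Proof.
have := logmix_lip b0 x y cg0; have := logmix_lip b0 x y cg; rewrite /llr.
move: (logmix a b g0 x) (logmix a b g0 y) (logmix a b g x) (logmix a b g y) => p q r t h1 h2.
have -> : p - r - (q - t) = (p - q) - (r - t) by ring.
apply: le_trans (ler_normB _ _) _; lra.
Qed.

(** The two affine tails have the same slope, see [logmix_tail]. *)
Lemma llr_tail x y s : `|s| = 1 -> a <= s * x -> a <= s * y -> llr x = llr y.
Proof.
move=> s1 sx sy; have := logmix_tail b0 cg0 s1 sx sy.
have := logmix_tail b0 cg s1 sx sy; rewrite /llr.
by move: (logmix a b g0 x) (logmix a b g0 y) (logmix a b g x) (logmix a b g y) => *; lra.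
Qed.

Lemma measurable_llr : measurable_fun [set: R] llr.
Proof.
apply: measurable_funB; apply: measurableT_comp => //; try exact: measurable_ln;
  exact: measurable_mixture.
Qed.

Lemma mixture_ratio x : mixture_pdf a b g x = mixture_pdf a b g0 x * expR (- llr x).
Proof.
by rewrite !(mixtureE b0)// -expRD /llr; congr expR; ring.
Qed.

Variable (p : nat).
Definition mesh : R := 2 * a / p.+1%:R.
Definition node (k : nat) : R := - a + k%:R * mesh.
(** The index of the cell of [-a, a] that contains [x]; the points on the left of
    [-a] go to the first cell ([truncn] vanishes on negative numbers), the points
    on the right of [a] to the last one. *)
Definition cell x : 'I_p.+1 := inord (minn p (Num.truncn ((x + a) / mesh))).

Lemma mesh_gt0 : 0 < mesh. Proof. by rewrite divr_gt0// mulr_gt0. Qed.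

Lemma cellE x : cell x = minn p (Num.truncn ((x + a) / mesh)) :> nat.
Proof. by rewrite inordK// ltnS geq_minl. Qed.

Lemma mesh_div : mesh / b = llr_range / p.+1%:R.
Proof.
have n0 : p.+1%:R != 0 :> R by rewrite pnatr_eq0.
by rewrite /mesh /llr_range; move: p.+1%:R n0 => N n0; field; rewrite n0 gt_eqF.
Qed.

Lemma nodeS k : node k.+1 - node k = mesh.
Proof. by rewrite /node -natr1; ring. Qed.

Lemma node_last : node p.+1 = a.
Proof. have n0 : p.+1%:R != 0 :> R by rewrite pnatr_eq0.
by rewrite /node /mesh; move: p.+1%:R n0 => N n0; field. Qed.

Lemma cell_itv x (k : 'I_p.+1) : node k <= x < node k.+1 -> cell x = k.
Proof.
move=> H; apply: val_inj; rewrite /= cellE.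
have -> : Num.truncn ((x + a) / mesh) = k.
  apply: Num.Theory.truncn_def; move: H; rewrite /node.
  rewrite ler_pdivlMr ?mesh_gt0// ltr_pdivrMr ?mesh_gt0//.
  by move=> /andP[? ?]; apply/andP; split; lra.
by apply/minn_idPr; rewrite -ltnS.
Qed.

Lemma measurable_cell (k : 'I_p.+1) : measurable [set x : RT | cell x = k].
Proof.
have mge j : measurable [set x : RT | (j <= minn p (Num.truncn ((x + a) / mesh)))%N].
  case: j => [|j]; first by rewrite (_ : [set _ | _] = setT)//; apply/seteqP.
  have [jp|jp] := ltnP j p; last first.
    rewrite (_ : [set _ | _] = set0)//; apply/seteqP; split => x //=.
    by rewrite leq_min ltnNge jp.
  rewrite (_ : [set _ | _] = `[node j.+1, +oo[%classic); first exact: measurable_itv.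
  apply/seteqP; split => x /=; rewrite in_itv/= andbT leq_min jp /=
    Num.Theory.truncn_gt_nat ler_pdivlMr ?mesh_gt0// /node; lra.
rewrite (_ : [set _ | _] = [set x : RT | (k <= minn p (Num.truncn ((x + a) / mesh)))%N]
   `\` [set x : RT | (k.+1 <= minn p (Num.truncn ((x + a) / mesh)))%N]).
  exact: measurableD.
apply/seteqP; split => x /=.
  by move=> <-; rewrite cellE; split; rewrite ?ltnn.
move=> [h1 h2]; apply: val_inj; rewrite /= cellE; apply/eqP; rewrite eqn_leq h1 andbT.
by rewrite leqNgt; apply/negP.
Qed.

(** The unbounded end cells are harmless since the ratio is constant beyond [-a]
    and [a]. *)
Lemma llr_cell x : `|llr x - llr (node (cell x))| <= 2 * mesh / b.
Proof.
have m0 := mesh_gt0.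
have lip y z : `|y - z| <= mesh -> `|llr y - llr z| <= 2 * mesh / b.
  move=> h; apply: le_trans (llr_lip y z) _.
  by rewrite ler_pM2r ?invr_gt0// ler_pM2l.
have [xa|xa] := leP x (- a).
  rewrite (@llr_tail x (- a) (-1)) ?normrN1//; [|lra|lra].
  have -> : node (cell x) = - a.
    rewrite cellE (_ : Num.truncn _ = 0%N) ?minn0 /node ?mul0r ?addr0//.
    apply/Num.Theory.truncn0Pn; rewrite -ltNge ltr_pdivrMr//; lra.
  by rewrite subrr normr0 divr_ge0 ?mulr_ge0// ltW.
have [ax|ax] := leP a x.
  rewrite (@llr_tail x a 1) ?normr1//; [|lra|lra].
  apply: lip; have -> : node (cell x) = node p.
    rewrite cellE; congr node; apply/minn_idPl.
    rewrite Num.Theory.truncn_ge_nat; last by rewrite divr_ge0//; lra.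
    rewrite ler_pdivlMr//; have := node_last; rewrite /node -natr1; lra.
  by rewrite -node_last nodeS ger0_norm// ltW.
have y0 : 0 <= (x + a) / mesh by rewrite divr_ge0//; lra.
have := Num.Theory.truncn_itv y0.
have kp : (Num.truncn ((x + a) / mesh) <= p)%N.
  rewrite -ltnS Num.Theory.truncn_lt_nat// ltr_pdivrMr//.
  have := node_last; rewrite /node; lra.
have -> : Num.truncn ((x + a) / mesh) = cell x by rewrite cellE; symmetry; apply/minn_idPr.
rewrite ler_pdivlMr// ltr_pdivrMr// -natr1 => /andP[h1 h2].
apply: lip; rewrite ler_norml /node; apply/andP; split; lra.
Qed.

(** Twice the constant of [logmix_node_tv], as the ratio involves two mixtures; it
    also bounds the first differences. *)
Definition variation_c : R := 24 * llr_range ^+ 2 + 4 * llr_range.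

Lemma llr_node_diff k : `|llr (node k.+1) - llr (node k)| <= variation_c / p.+1%:R.
Proof.
apply: le_trans (llr_lip _ _) _; rewrite nodeS ger0_norm ?(ltW mesh_gt0)//.
rewrite -mulrA mesh_div mulrA ler_pM2r ?invr_gt0// /variation_c.
have := llr_range_gt0 a0 b0; have := sqr_ge0 llr_range; lra.
Qed.

Lemma logmix_node_tv h : carried a h ->
  \sum_(j < p.-1) `|logmix a b h (node j.+2) - 2 * logmix a b h (node j.+1)
     + logmix a b h (node j)| <= (12 * llr_range ^+ 2 + 2 * llr_range) / p.+1%:R.
Proof.
move=> ch.
have mb := mesh_div.
have n0 : 0 < p.+1%:R :> R by rewrite ltr0n.
have l0 := llr_range_gt0 a0 b0.
have D k : `|logmix a b h (node k.+1) - logmix a b h (node k)| <= llr_range / p.+1%:R.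
  apply: (le_trans (logmix_lip b0 _ _ ch)).
  by rewrite nodeS ger0_norm ?(ltW mesh_gt0)// mb.
have := @sum_second_diff_le R (fun k => logmix a b h (node k)) (6 * (llr_range / p.+1%:R) ^+ 2)
  (llr_range / p.+1%:R) p.-1 _ (D _) (D _) _.
move=> H; apply: le_trans (H _ _) _.
- by rewrite mulr_ge0// sqr_ge0.
- move=> k _; have := logmix_semiconvex b0 (node k.+1) ch (ltW mesh_gt0).
  have -> : node k.+1 + mesh = node k.+2 by rewrite -(nodeS k.+1) addrC subrK.
  have -> : node k.+1 - mesh = node k by rewrite -(nodeS k) opprB addrC subrK.
  by rewrite mb.
have pn : p.-1%:R <= p.+1%:R :> R by rewrite ler_nat (leq_trans (leq_pred _)).
rewrite [X in _ <= X](_ : _ = 2 * (6 * (llr_range / p.+1%:R) ^+ 2) * p.+1%:R + 2 * (llr_range / p.+1%:R)); last first.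
  by move: p.+1%:R n0 => N n0; field; rewrite gt_eqF.
by rewrite lerD2r ler_wpM2l// mulr_ge0// mulr_ge0// sqr_ge0.
Qed.

Lemma llr_node_tv :
  \sum_(j < p.-1) `|llr (node j.+2) - 2 * llr (node j.+1) + llr (node j)| <= variation_c / p.+1%:R.
Proof.
have h1 := logmix_node_tv cg0; have h2 := logmix_node_tv cg.
rewrite [X in _ <= X](_ : _ = (12 * llr_range ^+ 2 + 2 * llr_range) / p.+1%:R +
  (12 * llr_range ^+ 2 + 2 * llr_range) / p.+1%:R); last by rewrite -mulrDl /variation_c; congr (_ / _); ring.
apply: le_trans (lerD h1 h2); rewrite -big_split /=; apply: ler_sum => j _.
apply: le_trans (ler_normB _ _); rewrite le_eqVlt; apply/orP; left; apply/eqP.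
congr `|_|; rewrite /llr; move: (logmix a b g0) (logmix a b g) => u v; ring.
Qed.

End llr.

(** * From the likelihood inequality to the quadratic loss *)

Section exp_inequalities.
Context {R : realType}.
Implicit Types t l : R.

(** With [E = exp (- t / 2)], the right-hand side is at least [(1 - E)^2] because
    [1 - t / 2 <= E], and [|1 - E|] is bounded below by the mean value theorem. *)
Lemma expR_sub1_ge t l : 0 <= l -> `|t| <= l ->
  expR (- l) / 4 * t ^+ 2 <= expR (- t) - 1 + t.
Proof.
move=> l0; rewrite ler_norml => /andP[lt tl].
set E := expR (- t / 2); set c := expR (- l / 2).
have E2 : expR (- t) = E ^+ 2 by rewrite /E -expRM_natl; congr expR; field.
have c2 : expR (- l) = c ^+ 2 by rewrite /c -expRM_natl; congr expR; field.
have E0 : 0 < E by exact: expR_gt0.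
have c0 : 0 < c by exact: expR_gt0.
have c1 : c <= 1 by rewrite /c expR_le1; lra.
have h1 : 1 - t / 2 <= E by have := expR_ge1Dx (- t / 2); rewrite -/E; lra.
have h2 : (1 - E) ^+ 2 <= expR (- t) - 1 + t by rewrite E2; nra.
apply: le_trans h2; rewrite c2.
have -> : c ^+ 2 / 4 * t ^+ 2 = (c * t / 2) ^+ 2 by field.
rewrite -(real_normK (num_real (c * t / 2))) -(real_normK (num_real (1 - E))) lerXn2r ?nnegrE//.
have [t0|t0] := leP 0 t.
  have cE : c <= E by rewrite ler_expR; lra.
  have h3 : (1 + t / 2) * E <= 1.
    have := expR_ge1Dx (t / 2); rewrite -(ler_pM2r E0) => H; apply: le_trans H _.
    by rewrite /E -expRD (_ : _ + _ = 0) ?expR0//; lra.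
  rewrite ger0_norm; last by rewrite divr_ge0// mulr_ge0// ltW.
  apply: le_trans (ler_norm _); nra.
rewrite ler0_norm; last by rewrite mulr_le0_ge0// mulr_ge0_le0 ?ltW.
rewrite -[X in _ <= X]normrN; apply: le_trans (ler_norm _); nra.
Qed.

Lemma expR_lip t l : 0 <= l -> `|t| <= l -> `|1 - expR (- t)| <= expR l * `|t|.
Proof.
move=> l0 tl; have l1 : 1 <= expR l by have := expR_ge1Dx l; lra.
have [t0|t0] := leP 0 t.
  rewrite ger0_norm ?subr_ge0 ?expR_le1; last lra.
  rewrite (ger0_norm t0); have := expR_ge1Dx (- t); nra.
rewrite ler0_norm; last by rewrite subr_le0 -expR0 ler_expR; lra.
rewrite (ltr0_norm t0) opprB.
have h1 : expR (- t) <= expR l by rewrite ler_expR; move: tl; rewrite ltr0_norm.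
have : expR (- t) - 1 <= expR (- t) * (- t).
  have := expR_ge1Dx t; rewrite -(ler_pM2l (expR_gt0 (- t))) -expRD addNr expR0.
  move: (expR (- t)) => u; lra.
move: (expR (- t)) (expR l) h1 => u v h1; nra.
Qed.

End exp_inequalities.

Section weighted_mean.
Context d (T : measurableType d) (R : realType) (nu : {measure set T -> \bar R}).
Implicit Types (f k : T -> R) (c C : R).

Definition bounded_measurable f :=
  measurable_fun [set: T] f /\ exists C, forall x, `|f x| <= C.
Local Notation bmf := bounded_measurable.

Lemma bmfD f k : bmf f -> bmf k -> bmf (fun x => f x + k x).
Proof.
move=> [mf [C fC]] [mk [D kD]]; split; first exact: measurable_funD.
by exists (C + D) => x; rewrite (le_trans (ler_normD _ _))// lerD.
Qed.

Lemma bmfM f k : bmf f -> bmf k -> bmf (fun x => f x * k x).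
Proof.
move=> [mf [C fC]] [mk [D kD]]; split; first exact: measurable_funM.
by exists (C * D) => x; rewrite normrM ler_pM.
Qed.

Lemma bmf_cst c : bmf (fun=> c).
Proof. by split=> //; exists `|c|. Qed.

Lemma bmfZ c f : bmf f -> bmf (fun x => c * f x).
Proof. exact/bmfM/bmf_cst. Qed.

Lemma bmf_sqr f : bmf f -> bmf (fun x => f x ^+ 2).
Proof. by move=> bf; exact: bmfM. Qed.

Lemma bmf_norm f : bmf f -> bmf (fun x => `|f x|).
Proof.
move=> [mf [C fC]]; split; first exact: measurableT_comp.
by exists C => x; rewrite normr_id.
Qed.

Lemma bmf_sum n (f : 'I_n -> T -> R) : (forall i, bmf (f i)) ->
  bmf (fun x => \sum_(i < n) f i x).
Proof.
elim: n f => [|n IH] f bf.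
  under eq_fun do rewrite big_ord0.
  exact: bmf_cst.
under eq_fun do rewrite big_ord_recl.
by apply: bmfD => //; exact: IH.
Qed.

Lemma bmf_indic (A : set T) : measurable A -> bmf (\1_A).
Proof.
move=> mA; split; first exact: measurable_indic.
by exists 1 => x; rewrite indicE; case: (_ \in _); rewrite ?normr1 ?normr0.
Qed.

(** The mean of [f] for the probability of density [w] with respect to [nu].  The
    case of a probability [nu] with [w = 1] makes the same lemmas available
    for expectations. *)
Definition mean (w : T -> R) f : R := \int[nu]_x (w x * f x).

Definition density (w : T -> R) := [/\ measurable_fun [set: T] w,
  forall x, 0 <= w x & (\int[nu]_x (w x)%:E = 1)%E].

Variable w : T -> R.
Hypothesis dw : density w.

Lemma density_integrable : nu.-integrable [set: T] (EFin \o w).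
Proof.
have [mw w0 w1] := dw; apply/integrableP; split; first exact/measurable_EFinP.
under eq_integral do rewrite /= ger0_norm//.
by rewrite w1 ltry.
Qed.

Lemma bmf_int f : bmf f -> nu.-integrable [set: T] (EFin \o (fun x => w x * f x)).
Proof.
have [mw w0 _] := dw; move=> [mf [C fC]].
have := integrableZl measurableT C density_integrable.
apply: le_integrable => //; first exact/measurable_EFinP/measurable_funM.
move=> x _ /=; rewrite lee_fin !normrM mulrC ler_wpM2r//.
by apply: le_trans (fC x) (ler_norm _).
Qed.

Lemma meanD f k : bmf f -> bmf k -> mean w (fun x => f x + k x) = mean w f + mean w k.
Proof.
move=> bf bk; rewrite /mean -RintegralD//; [|exact: bmf_int..].
by apply: eq_Rintegral => x _; rewrite mulrDr.
Qed.

Lemma meanZ c f : bmf f -> mean w (fun x => c * f x) = c * mean w f.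
Proof.
move=> bf; rewrite /mean -RintegralZl//; last exact: bmf_int.
by apply: eq_Rintegral => x _; rewrite mulrCA.
Qed.

Lemma mean_cst c : mean w (fun=> c) = c.
Proof.
have [_ _ w1] := dw.
rewrite /mean; under eq_Rintegral do rewrite mulrC.
rewrite RintegralZl//; last exact: density_integrable.
by rewrite /Rintegral w1 mulr1.
Qed.

Lemma le_mean f k : bmf f -> bmf k -> (forall x, f x <= k x) -> mean w f <= mean w k.
Proof.
have [_ w0 _] := dw.
move=> bf bk fk; apply: le_Rintegral => //; [exact: bmf_int..|].
by move=> x _; rewrite ler_wpM2l.
Qed.

Lemma mean_sum n (f : 'I_n -> T -> R) : (forall i, bmf (f i)) ->
  mean w (fun x => \sum_(i < n) f i x) = \sum_(i < n) mean w (f i).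
Proof.
elim: n f => [|n IH] f bf.
  under eq_fun do rewrite big_ord0.
  by rewrite mean_cst big_ord0.
under eq_fun do rewrite big_ord_recl.
by rewrite meanD//; [rewrite IH// big_ord_recl|exact: bmf_sum].
Qed.

End weighted_mean.
Notation bmf := bounded_measurable.

Section population.
Context {R : realType} (a b : R) (a0 : 0 < a) (b0 : 0 < b).
Notation RT := (measurableTypeR R).
Notation mu := (@lebesgue_measure R).
Variable g0 : probability RT R.
Hypothesis cg0 : carried a g0.
Implicit Types (f : R -> R) (x y c C : R) (g : probability RT R).
Notation llr_range := (llr_range a b).
Notation m0 := (mixture_pdf a b g0).

Lemma mixture_density g : carried a g -> density mu (mixture_pdf a b g).
Proof.
move=> cg; split; [exact: measurable_mixture| |exact: integral_mixture].
by move=> x; rewrite ltW// mixture_gt0.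
Qed.

Notation W := (mean mu m0).
Let dm0 := mixture_density cg0.
Let WD := meanD dm0.
Let WZ := meanZ dm0.
Let W_cst := mean_cst dm0.
Let W_le := le_mean dm0.

Variable (p : nat).
Notation cell := (@cell R a p).
Notation node := (@node R a p).
Notation mesh := (@mesh R a p).

Definition cell_mass (k : 'I_p.+1) : R := W (fun x => (cell x == k)%:R).

Lemma bmf_cell (k : 'I_p.+1) : bmf (fun x => (cell x == k)%:R : R).
Proof.
split; last by exists 1 => x; case: (_ == _); rewrite ?normr1 ?normr0.
rewrite (_ : (fun _ => _) = \1_([set x : RT | cell x = k])).
  by apply: measurable_indic; exact: measurable_cell.
apply/funext => x; rewrite indicE; congr (_%:R); congr nat_of_bool.
by apply/idP/idP; rewrite inE => /eqP.
Qed.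

Lemma sum_cell (c : 'I_p.+1 -> R) x : \sum_k c k * (cell x == k)%:R = c (cell x).
Proof.
rewrite (bigD1 (cell x))//= eqxx mulr1 big1 ?addr0// => k.
by rewrite eq_sym => /negbTE ->; rewrite mulr0.
Qed.

Lemma W_cells (c : 'I_p.+1 -> R) :
  bmf (fun x => \sum_(k < p.+1) c k * (cell x == k)%:R) /\
  W (fun x => \sum_(k < p.+1) c k * (cell x == k)%:R) = \sum_(k < p.+1) c k * cell_mass k.
Proof.
have bc k : bmf (fun x : R => c k * (cell x == k)%:R) by exact/bmfZ/bmf_cell.
split; first exact: bmf_sum.
by rewrite (mean_sum dm0)//; apply: eq_bigr => k _; rewrite WZ//; exact: bmf_cell.
Qed.

Lemma cell_mass_sum : \sum_(k < p.+1) cell_mass k = 1.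
Proof.
have [_] := W_cells (fun=> 1).
rewrite (_ : (fun _ => _) = fun=> 1); last by apply/funext => x; rewrite sum_cell.
by rewrite W_cst => ->; apply: eq_bigr => k _; rewrite mul1r.
Qed.

Lemma cell_mass_ge0 (k : 'I_p.+1) : 0 <= cell_mass k.
Proof.
by rewrite -(W_cst 0); apply: W_le => [||x]; [exact: bmf_cst|exact: bmf_cell|exact: ler0n].
Qed.

(** A lower bound of the mixture densities on [-a, a], by comparison with the
    Laplace density at distance [2 * a]. *)
Definition density_lb : R := expR (- (2 * a / b)) / (2 * b).

Lemma density_lb_gt0 : 0 < density_lb.
Proof. by rewrite divr_gt0 ?expR_gt0// mulr_gt0. Qed.

Lemma mixture_ge x : - a <= x <= a -> density_lb <= m0 x.
Proof.
move=> xa; have /andP[h _] := mixture_sandwich b0 x cg0; apply: le_trans h.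
rewrite /density_lb /laplace_pdf mulrC mulrCA ler_wpM2l ?invr_ge0 ?mulr_ge0 ?(ltW b0)//.
rewrite -expRD ler_expR mulNr -opprD lerN2 -mulrDl ler_wpM2r ?invr_ge0 ?(ltW b0)//.
by move: xa; rewrite -ler_norml; lra.
Qed.

(** Every cell contains an interval of length [mesh] inside [-a, a], where the
    density is bounded below. *)
Lemma cell_mass_ge (k : 'I_p.+1) : density_lb * mesh <= cell_mass k.
Proof.
have mI : measurable (`[node k, node k.+1[%classic : set RT) by exact: measurable_itv.
have Nk : node k.+1 = node k + mesh by rewrite -(nodeS a p k) addrC subrK.
have ms0 := @mesh_gt0 R a a0 p.
have muI : mu `[node k, node k.+1[%classic = mesh%:E.
  have := @lebesgue_measure_itv R `[node k, node k.+1[%R.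
  have lt : node k < node k.+1 by rewrite Nk ltrDl.
  by rewrite /= lte_fin lt -EFinD (nodeS a p k).
have -> : density_lb * mesh = \int[mu]_(x in `[node k, node k.+1[%classic) density_lb.
  rewrite Rintegral_cst//=; congr (_ * _); exact: (congr1 fine (esym muI)).
rewrite /cell_mass /W [X in _ <= X](_ : _ = \int[mu]_(x in [set: R]) (m0 x * (cell x == k)%:R))//.
rewrite Rintegral_mkcond; apply: le_Rintegral => //.
- rewrite -restrict_EFin; apply: (integrable_mkcond _ mI).1.
  apply: measurable_bounded_integrable => //.
    by apply: (@le_lt_trans _ _ mesh%:E); rewrite ?ltry// -muI.
  by exists `|density_lb|; split=> [|M M0 x _]; rewrite ?num_real// ltW.
- exact: (bmf_int dm0 (bmf_cell k)).
move=> x _; rewrite patchE; case: ifPn => [|_].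
  rewrite inE /= in_itv /= => xk; rewrite (cell_itv a0 xk) eqxx mulr1.
  apply: mixture_ge; move: xk => /andP[h1 h2].
  have hp : k.+1%:R <= p.+1%:R :> R by rewrite ler_nat.
  have := node_last a p; have h3 := ler_wpM2r (ltW ms0) hp.
  have := mulr_ge0 (ler0n R k) (ltW ms0).
  move: h1 h2 h3; rewrite /node => *; apply/andP; split; lra.
by rewrite mulr_ge0 ?ler0n// ltW// mixture_gt0.
Qed.


Variable g : probability RT R.
Hypothesis cg : carried a g.
Notation L := (llr a b g0 g).

Lemma bmf_llr : bmf L.
Proof. by split; [exact: measurable_llr|exists llr_range; exact: llr_bound]. Qed.

Definition llr_sq : R := W (fun x => L x ^+ 2).

(** Since [m0 * exp (- L)] is a probability density, the mean of [L] is also the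
    mean of [exp (- L) - 1 + L], a function comparable to [L^2] on a bounded range. *)
Lemma llr_sq_le_kl : expR (- llr_range) / 4 * llr_sq <= W L.
Proof.
have lam0 := llr_range_gt0 a0 b0.
rewrite -WZ; last exact/bmf_sqr/bmf_llr.
have bE : bmf (fun x => expR (- L x)).
  split.
    apply: measurableT_comp; first exact: measurable_expR.
    by apply: measurableT_comp => //; exact: measurable_llr.
  exists (expR llr_range) => x; rewrite ger0_norm ?expR_ge0// ler_expR.
  by have := llr_bound b0 cg0 cg x; rewrite ler_norml; lra.
have E1 : W (fun x => expR (- L x)) = 1.
  have [_ _ m1] := mixture_density cg.
  rewrite -[RHS]/(fine 1) -m1; apply: eq_Rintegral => x _.
  by rewrite (mixture_ratio b0 cg0 cg).
have -> : W L = W (fun x => expR (- L x) + -1 + L x).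
  have bE1 := bmfD bE (bmf_cst _ (-1)).
  rewrite (WD bE1 bmf_llr) (WD bE (bmf_cst _ (-1))).
  by rewrite E1 W_cst subrr add0r.
apply: W_le.
- by apply/bmfZ/bmf_sqr/bmf_llr.
- by apply: bmfD; [apply: bmfD => //; exact: bmf_cst|exact: bmf_llr].
- by move=> x; apply: expR_sub1_ge; [exact: ltW|exact: llr_bound].
Qed.

Lemma kl_le_cells : W L <= \sum_(k < p.+1) L (node k) * cell_mass k + 2 * mesh / b.
Proof.
have [bS WS] := W_cells (fun k : 'I_p.+1 => L (node k)).
rewrite -WS -[X in _ + X]W_cst -WD//; last exact: bmf_cst.
apply: W_le; [exact: bmf_llr|by apply: bmfD => //; exact: bmf_cst|].
move=> x; rewrite sum_cell.
have := llr_cell a0 b0 cg0 cg p x; rewrite ler_norml.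
by move: (L x) (L (node (cell x))) (2 * mesh / b) => u v w /andP[]; lra.
Qed.

Lemma node_sq_le : density_lb * mesh * \sum_(k < p.+1) L (node k) ^+ 2 <=
  2 * llr_sq + 2 * (2 * mesh / b) ^+ 2.
Proof.
have [bS WS] := W_cells (fun k : 'I_p.+1 => L (node k) ^+ 2).
apply: (@le_trans _ _ (W (fun x => \sum_(k < p.+1) L (node k) ^+ 2 * (cell x == k)%:R))).
  rewrite WS mulr_sumr; apply: ler_sum => k _; rewrite mulrC ler_wpM2l ?sqr_ge0//.
  exact: cell_mass_ge.
rewrite -[X in _ + X]W_cst -WZ; last exact/bmf_sqr/bmf_llr.
rewrite -WD; [|by apply/bmfZ/bmf_sqr/bmf_llr|exact: bmf_cst].
apply: W_le => //; first by apply: bmfD; [apply/bmfZ/bmf_sqr/bmf_llr|exact: bmf_cst].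
move=> x; rewrite sum_cell.
have := llr_cell a0 b0 cg0 cg p x; move: (L x) (L (node (cell x))) (2 * mesh / b) => u v w.
rewrite ler_norml => /andP[h1 h2].
have : (u - v) ^+ 2 <= w ^+ 2 by nra.
by have := sqr_ge0 (u + (u - v)); nra.
Qed.

Lemma L1_le_llr_sq s : 0 < s ->
  \int[mu]_x `|mixture_pdf a b g x - m0 x| <= expR llr_range * (s / 2 + llr_sq / (2 * s)).
Proof.
move=> s0; have lam0 := llr_range_gt0 a0 b0.
have bL := bmf_llr; have bL2 := bmf_sqr bL.
have -> : \int[mu]_x `|mixture_pdf a b g x - m0 x| = W (fun x => `|1 - expR (- L x)|).
  apply: eq_Rintegral => x _; rewrite (mixture_ratio b0 cg0 cg) -{2}[m0 x]mulr1 -mulrBr.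
  by rewrite normrM ger0_norm ?ltW ?mixture_gt0// distrC.
have -> : expR llr_range * (s / 2 + llr_sq / (2 * s)) =
    W (fun x => expR llr_range * (s / 2 + (2 * s)^-1 * L x ^+ 2)).
  rewrite WZ; last by apply: bmfD; [exact: bmf_cst|exact: bmfZ].
  by rewrite WD; [rewrite W_cst WZ// [_ / (2 * s)]mulrC|exact: bmf_cst|exact: bmfZ].
apply: W_le.
- apply/bmf_norm; split.
    apply: measurable_funB => //; apply: measurableT_comp; first exact: measurable_expR.
    by apply: measurableT_comp => //; exact: measurable_llr.
  exists (expR llr_range * llr_range) => x.
  apply: le_trans (expR_lip (ltW lam0) (llr_bound b0 cg0 cg x)) _.
  by rewrite ler_wpM2l ?expR_ge0// llr_bound.
- by apply: bmfZ; apply: bmfD; [exact: bmf_cst|exact: bmfZ].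
move=> x; apply: le_trans (expR_lip (ltW lam0) (llr_bound b0 cg0 cg x)) _.
rewrite ler_wpM2l ?expR_ge0// -(real_normK (num_real (L x))).
have := @young_mul R (s / 2) 1 `|L x|; rewrite mul1r expr1n mulr1 => H.
apply: le_trans (H _) _; first by rewrite divr_gt0.
rewrite lerD2l mulrC (_ : 4 * (s / 2) = 2 * s)//; by field.
Qed.

Variable x : nat -> R.
Hypothesis max_g : loglik a b p.+1 x g0 <= loglik a b p.+1 x g.

Definition freq_dev (k : 'I_p.+1) : R :=
  (\sum_(i < p.+1) (cell (x i) == k)%:R) / p.+1%:R - cell_mass k.

(** Comparing the likelihoods of [g] and [g0] makes the empirical mean of [L]
    nonpositive; rounding the observations to nodes costs one modulus of
    continuity. *)
Lemma mean_llr_le : \sum_(k < p.+1) L (node k) *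
  ((\sum_(i < p.+1) (cell (x i) == k)%:R) / p.+1%:R) <= 2 * mesh / b.
Proof.
have n0 : 0 < p.+1%:R :> R by rewrite ltr0n.
have L0 : \sum_(i < p.+1) L (x i) <= 0.
  by rewrite /llr sumrB subr_le0.
under eq_bigr do rewrite mulrA mulr_sumr.
rewrite -mulr_suml exchange_big /= ler_pdivrMr//.
under eq_bigr do rewrite (sum_cell (fun k : 'I_p.+1 => L (node k))).
apply: (@le_trans _ _ (\sum_(i < p.+1) (L (x i) + 2 * mesh / b))).
  apply: ler_sum => i _.
  have := llr_cell a0 b0 cg0 cg p (x i); rewrite ler_norml.
  by move: (L (x i)) (L (node (cell (x i)))) (2 * mesh / b) => u v w /andP[]; lra.
rewrite big_split /= sumr_const card_ord -[X in _ + X]mulr_natr.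
by rewrite gerDr.
Qed.

Lemma llr_sq_le_dev : expR (- llr_range) / 4 * llr_sq <=
  - (\sum_(k < p.+1) L (node k) * freq_dev k) + 4 * mesh / b.
Proof.
apply: le_trans llr_sq_le_kl _; apply: le_trans kl_le_cells _.
have := mean_llr_le; rewrite /freq_dev.
rewrite (eq_bigr _ (fun (k : 'I_p.+1) _ => mulrBr (L (node k)) _ _)) sumrB.
by move: (\sum_(k < _) _) (\sum_(k < _) _) => u v; lra.
Qed.

(** The constant of [llr_sq_le_kl]. *)
Definition kl_c : R := expR (- llr_range) / 4.
(** The coefficient of the mean square in [linear_form_le], divided by [eps]. *)
Definition form_c : R := 1 + 4 * (3 * variation_c a b + 1) * (llr_range + 3 * variation_c a b).
(** Small enough for the quadratic term of [linear_form_le] to be absorbed by half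
    of the lower bound of the divergence. *)
Definition form_eps : R := kl_c * (density_lb * (2 * a)) / (4 * form_c).
Definition llr_sq_c (T : R) : R := 2 / kl_c * (2 * kl_c * llr_range ^+ 2 +
  (3 * T / (4 * form_eps) + 4 * (3 * variation_c a b + 1) * form_eps) + 4 * llr_range).

(** The basic inequality: [J] occurs on both sides of [llr_sq_le_dev], once with
    the constant [kl_c] and once, through [linear_form_le] and [node_sq_le], with
    at most [kl_c / 2], so that it can be solved for. *)
Lemma llr_sq_le (S : nat -> R) (T h : R) : 0 <= T -> 0 < h -> h <= 1 ->
  p.+1%:R * h ^+ 4 = 1 ->
  (forall k : 'I_p.+1, freq_dev k =
     S k - (1 - h ^+ 3) * (if (k : nat) is j.+1 then S j else 0)) ->
  h ^+ 3 * \sum_(j < p.+1) S j ^+ 2 + S p ^+ 2 <= T * h ^+ 4 ->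
  llr_sq <= llr_sq_c T * h ^+ 3.
Proof.
move=> T0 h0 h1 nh Sdev ST.
have n0 : p.+1%:R != 0 :> R by rewrite pnatr_eq0.
have hn : h ^+ 4 = p.+1%:R^-1 by apply: (mulfI n0); rewrite nh divff.
have lam0 := llr_range_gt0 a0 b0.
have c0 : 0 < kl_c by rewrite divr_gt0 ?expR_gt0.
have A0 : 0 < variation_c a b by rewrite addr_gt0// mulr_gt0// exprn_gt0.
have C0 : 0 < form_c.
  by rewrite ltr_pwDl// mulr_ge0 ?mulr_ge0 ?addr_ge0 ?(ltW A0) ?(ltW lam0) ?mulr_ge0 ?(ltW A0).
have d0 := density_lb_gt0.
have e0 : 0 < form_eps.
  by apply: divr_gt0; apply: mulr_gt0 => //; apply: mulr_gt0 => //; exact: mulr_gt0.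
have mh : mesh / b = llr_range * h ^+ 4 by rewrite mesh_div// hn.
have := @linear_form_le R (fun k : nat => L (node k)) S (variation_c a b) llr_range T h form_eps p
  (ltW A0) (ltW lam0) T0 h0 h1 e0 nh.
rewrite hn => /(_ (fun k _ => llr_bound b0 cg0 cg _)).
move=> /(_ (fun k _ => llr_node_diff a0 b0 cg0 cg p k) (llr_node_tv a0 b0 cg0 cg p)).
rewrite -hn => /(_ ST).
under eq_bigr do rewrite -Sdev.
rewrite -/form_c => F.
have := llr_sq_le_dev; rewrite -/kl_c -mulrA mh => B.
have Q := node_sq_le; rewrite -[2 * mesh / b]mulrA mh in Q.
have {}Q : density_lb * (2 * a) * (h ^+ 4 * \sum_(k < p.+1) L (node k) ^+ 2) <=
    2 * llr_sq + 8 * llr_range ^+ 2 * h ^+ 8.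
  move: Q; rewrite (_ : density_lb * mesh = density_lb * (2 * a) * h ^+ 4); last first.
    by rewrite /mesh hn; ring.
  rewrite -[X in X <= _ -> _]mulrA => Q; apply: le_trans Q _.
  by rewrite le_eqVlt; apply/orP; left; apply/eqP; ring.
have hh : h ^+ 8 <= h ^+ 3 by rewrite ler_wiXn2l// ltW.
have hh4 : h ^+ 4 <= h ^+ 3 by rewrite ler_wiXn2l// ltW.
set q := h ^+ 4 * _ in F Q; set J := llr_sq in B Q *.
have Fq : form_eps * form_c * q <= kl_c / 4 * (2 * J + 8 * llr_range ^+ 2 * h ^+ 3).
  have -> : form_eps * form_c * q = kl_c / 4 * (density_lb * (2 * a) * q).
    by rewrite /form_eps; field; rewrite gt_eqF.
  rewrite ler_wpM2l//; first by rewrite divr_ge0// ltW.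
  by apply: le_trans Q _; rewrite lerD2l ler_wpM2l// mulr_ge0// sqr_ge0.
have {}F := le_trans (ler_norm _) (le_trans (eq_ind _ (fun z => z <= _) F _ (esym (normrN _))) (lexx _)).
have Bh : 4 * (llr_range * h ^+ 4) <= 4 * llr_range * h ^+ 3.
  by rewrite mulrA ler_wpM2l// mulr_ge0// ltW.
rewrite /llr_sq_c; set e1 := _ / (4 * form_eps) + _.
have : kl_c / 2 * J <= (2 * kl_c * llr_range ^+ 2 + e1 + 4 * llr_range) * h ^+ 3.
  move: F Fq B Bh; rewrite -/e1; move: (h ^+ 3) (h ^+ 4) (\sum_(k < p.+1) _) => u v w.
  lra.
have k0 : 0 < 2 / kl_c by exact: divr_gt0.
rewrite -(ler_pM2l k0) => H.
rewrite -[X in _ <= X]mulrA [X in X <= _](_ : _ = 2 / kl_c * (kl_c / 2 * J))//.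
by field; rewrite gt_eqF.
Qed.

End population.

(** * Law and independence of the observations *)

Section rectangles.
Context d1 d2 (T1 : measurableType d1) (T2 : measurableType d2) (R : realType).

(** Rectangles form a pi-system that generates the product sigma-algebra. *)
Lemma eq_measure_rectangle (m1 m2 : {measure set (T1 * T2) -> \bar R}) :
  (m1 setT < +oo)%E ->
  (forall A B, measurable A -> measurable B -> m1 (A `*` B) = m2 (A `*` B)) ->
  forall E, measurable E -> m1 E = m2 E.
Proof.
move=> m1oo m12 E mE.
apply: (@measure_unique _ _ _ [set A `*` B | A in @measurable _ T1 & B in @measurable _ T2]
  (fun=> setT)) => //.
- exact: measurable_prod_measurableType.
- move=> _ _ [A mA [B mB <-]] [A' mA' [B' mB' <-]].
  exists (A `&` A'); first exact: measurableI.
  by exists (B `&` B'); [exact: measurableI|rewrite setXI].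
- by move=> _; exists setT => //; exists setT => //; rewrite setXTT.
- by apply: bigcup_const; exists 0%N.
- by move=> _ [A mA [B mB <-]]; exact: m12.
Qed.

End rectangles.

Section sampling.
Context {R : realType} (a b : R) (a0 : 0 < a) (b0 : 0 < b).
Notation RT := (measurableTypeR R).
Notation mu := (@lebesgue_measure R).
Variables (g0 : probability RT R).
Hypothesis cg0 : carried a g0.
Context (d : measure_display) (Omega : measurableType d) (P : probability Omega R).
Variables (theta Z : nat -> {RV P >-> RT}).
Hypotheses (theta_indep : independent_seq theta)
  (theta_law : forall i (B : set RT), measurable B -> distribution P (theta i) B = g0 B)
  (Z_indep : independent_seq Z)
  (Z_law : forall i (B : set RT), measurable B ->
     distribution P (Z i) B = (\int[mu]_(x in B) (laplace_pdf b x)%:E)%E)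
  (tZ_indep : independent_of theta Z).

Lemma sigma_seq_preimage (X : nat -> {RV P >-> RT}) i (A : set RT) :
  measurable A -> sigma_seq X (X i @^-1` A).
Proof. by move=> mA; apply: sub_sigma_algebra; exists i, A. Qed.

Lemma sigma_seqI (X : nat -> {RV P >-> RT}) E F :
  sigma_seq X E -> sigma_seq X F -> sigma_seq X (E `&` F).
Proof.
move=> sE sF.
exact: (@measurableI _ (g_sigma_algebraType [set E | exists i, exists2 B : set RT,
                 measurable B & E = X i @^-1` B]) E F sE sF).
Qed.

Lemma independent_pair (X : nat -> {RV P >-> RT}) i j (A B : set RT) :
  independent_seq X -> i != j -> measurable A -> measurable B ->
  P (X i @^-1` A `&` X j @^-1` B) = (P (X i @^-1` A) * P (X j @^-1` B))%E.
Proof.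
move=> iX ij mA mB.
have := iX [:: i; j] (fun k => if k == i then A else B).
rewrite !big_cons big_nil /= eqxx eq_sym (negbTE ij) mule1 inE ij => <- //.
  congr (P _); apply/seteqP; split => [w [Aw Bw] k /=|w H].
    rewrite !inE => /orP[/eqP->|/eqP->]; first by rewrite eqxx.
    by rewrite eq_sym (negbTE ij).
  split; first by have := H i; rewrite /= eqxx; apply; rewrite inE eqxx.
  have := H j; rewrite /= eq_sym (negbTE ij); apply.
  by rewrite !inE eqxx orbT.
by move=> k; case: ifP.
Qed.

Let latent i w : RT * RT := (theta i w, Z i w).

Lemma measurable_latent i : measurable_fun [set: Omega] (latent i).
Proof. exact: measurable_fun_pair. Qed.

Lemma latent_rect i (A B : set RT) : latent i @^-1` (A `*` B) = theta i @^-1` A `&` Z i @^-1` B.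
Proof. by []. Qed.

Lemma measurable_latent_preimage i (E : set (RT * RT)) : measurable E -> measurable (latent i @^-1` E).
Proof. by move=> mE; rewrite -[X in measurable X]setTI; exact: measurable_latent. Qed.

Lemma latent_law_rect i (A B : set RT) : measurable A -> measurable B ->
  P (latent i @^-1` (A `*` B)) = (P (theta i @^-1` A) * P (Z i @^-1` B))%E.
Proof.
by move=> mA mB; rewrite latent_rect; apply: tZ_indep; exact: sigma_seq_preimage.
Qed.

Lemma latent_indep_rect i j (A B C D : set RT) : i != j ->
  measurable A -> measurable B -> measurable C -> measurable D ->
  P (latent i @^-1` (A `*` B) `&` latent j @^-1` (C `*` D)) =
  (P (latent i @^-1` (A `*` B)) * P (latent j @^-1` (C `*` D)))%E.
Proof.
move=> ij mA mB mC mD; rewrite !latent_law_rect// !latent_rect.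
rewrite (_ : _ `&` _ = (theta i @^-1` A `&` theta j @^-1` C) `&` (Z i @^-1` B `&` Z j @^-1` D)); last by rewrite setIACA.
rewrite tZ_indep; [|by apply: sigma_seqI; exact: sigma_seq_preimage..].
by rewrite !independent_pair// muleACA.
Qed.


(** Both sides are finite measures in [E], so that rectangles suffice.  Applied twice,
    this lifts independence from rectangles to measurable sets of the plane in
    each of the two variables. *)
Lemma latent_indep_event i (F : set Omega) : measurable F ->
  (forall A B : set RT, measurable A -> measurable B ->
     P (latent i @^-1` (A `*` B) `&` F) = (P (latent i @^-1` (A `*` B)) * P F)%E) ->
  forall E : set (RT * RT), measurable E ->
    P (latent i @^-1` E `&` F) = (P (latent i @^-1` E) * P F)%E.
Proof.
move=> mF H E mE.
have pf0 : 0 <= fine (P F) by rewrite fine_ge0.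
pose r : {nonneg R} := NngNum pf0.
pose m1 := image_measure (mrestr P mF) (measurable_latent i).
pose m2 : {measure set (RT * RT) -> \bar R} := mscale r (image_measure P (measurable_latent i)).
have e2 (S : set (RT * RT)) : m2 S = (P (latent i @^-1` S) * P F)%E.
  by rewrite /m2 /= /mscale /= fineK ?fin_num_measure// muleC.
rewrite -e2.
apply: (@eq_measure_rectangle _ _ RT RT R m1 m2) => //.
  rewrite /m1 image_measureE /mrestr.
  by apply: le_lt_trans (probability_le1 _ _) (ltry 1); apply: measurableI => //; exact: measurable_latent_preimage.
by move=> A B mA mB; exact: etrans (H A B mA mB) (esym (e2 _)).
Qed.

Lemma latent_indep i j (E F : set (RT * RT)) : i != j -> measurable E -> measurable F ->
  P (latent i @^-1` E `&` latent j @^-1` F) = (P (latent i @^-1` E) * P (latent j @^-1` F))%E.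
Proof.
move=> ij mE mF; apply: latent_indep_event => //; first exact: measurable_latent_preimage.
move=> A B mA mB; rewrite setIC muleC; apply: latent_indep_event => //.
  by apply: measurable_latent_preimage; exact: measurableX.
by move=> C D mC mD; rewrite setIC muleC; exact: latent_indep_rect.
Qed.

Variable X : nat -> Omega -> R.
Hypothesis X_def : forall i w, X i w = theta i w + Z i w.

Let sum_pre (B : set RT) : set (RT * RT) := [set z | B (z.1 + z.2)].

Lemma measurable_sum_pre (B : set RT) : measurable B -> measurable (sum_pre B).
Proof.
move=> mB; rewrite -[sum_pre B]setTI.
have : measurable_fun [set: RT * RT] (fun z => z.1 + z.2 : RT).
  exact: measurable_funD.
by apply.
Qed.

Lemma X_preimage i B : X i @^-1` B = latent i @^-1` (sum_pre B).
Proof. by apply/seteqP; split => w; rewrite /sum_pre /= X_def. Qed.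

Lemma measurable_X i (B : set RT) : measurable B -> measurable (X i @^-1` B).
Proof. by move=> mB; rewrite X_preimage; apply: measurable_latent_preimage; exact: measurable_sum_pre. Qed.

Lemma X_indep i j (B C : set RT) : i != j -> measurable B -> measurable C ->
  P (X i @^-1` B `&` X j @^-1` C) = (P (X i @^-1` B) * P (X j @^-1` C))%E.
Proof.
by move=> ij mB mC; rewrite !X_preimage; apply: latent_indep => //; exact: measurable_sum_pre.
Qed.

(** By independence the pair of latent variables has the product law; the mass that
    it gives to the preimage of [B] under the sum is computed by Tonelli's theorem
    and a translation of the Lebesgue measure. *)
Lemma X_law i (B : set RT) : measurable B ->
  P (X i @^-1` B) = (\int[mu]_x (\1_B x * mixture_pdf a b g0 x)%:E)%E.
Proof.
move=> mB; rewrite X_preimage.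
pose m1 := distribution P (theta i); pose m2 := distribution P (Z i).
pose M := image_measure P (measurable_latent i).
rewrite -[LHS]/(M (sum_pre B)).
rewrite -(@product_measure_unique _ _ RT RT R m1 m2 M); last 2 first.
- by move=> A C mA mC; exact: latent_law_rect.
- exact: measurable_sum_pre.
rewrite mixture_tonelli//.
rewrite /product_measure1.
rewrite (eq_measure_integral g0); last by move=> A mA _; exact: theta_law.
apply: eq_integral => t _; rewrite /=.
have -> : xsection (sum_pre B) t = [set z | B (z + t)].
  by apply/seteqP; split => z; rewrite /xsection /sum_pre /= inE /= addrC.
have mBt : measurable [set z : RT | B (z + t)].
  by rewrite -[X in measurable X]setTI; exact: measurable_shift.
rewrite Z_law// integral_mkcond.
rewrite -(@ge0_integral_shift _ t (fun y => (\1_B y * laplace_pdf b (y - t))%:E)).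
- apply: eq_integral => z _; rewrite patchE indicE addrK.
  have -> : (z \in [set z0 | B (z0 + t)]) = (z + t \in B) by apply/idP/idP; rewrite !inE.
  by case: ifP; rewrite ?mul1r ?mul0r.
- apply/measurable_EFinP; apply: measurable_funM; first exact: measurable_indic.
  by apply: measurable_laplace_shift => //; exact: measurable_funB.
- by move=> z; rewrite lee_fin mulr_ge0 ?indicE ?ler0n// ltW// laplace_gt0.
Qed.

End sampling.

(** * Deviations of empirical frequencies *)

Section multinomial.
Context d (T : measurableType d) (R : realType) (P : probability T R).
Variables (m : nat) (Y : nat -> T -> 'I_m) (q : 'I_m -> R).
Hypothesis mY : forall i k, measurable [set w | Y i w = k].
Hypothesis PY : forall i k, P [set w | Y i w = k] = (q k)%:E.
Hypothesis PYY : forall i j k l, i != j ->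
  P [set w | Y i w = k /\ Y j w = l] = (q k * q l)%:E.
Implicit Types (c : 'I_m -> R).

Let one : T -> R := fun=> 1.
Notation E := (mean P one).

Lemma one_density : density P one.
Proof.
split; [exact: measurable_cst|by move=> x; exact: ler01|].
by rewrite /one integral_cst// mul1e; exact: probability_setT.
Qed.
Let d1 := one_density.

Lemma mean_indic (A : set T) : measurable A -> E (\1_A) = fine (P A).
Proof.
move=> mA; rewrite /mean; under eq_Rintegral do rewrite mul1r.
by rewrite /Rintegral integral_indic// setIT.
Qed.

Lemma indicYE i k : (fun w => (Y i w == k)%:R) = \1_[set w | Y i w = k] :> (T -> R).
Proof.
by apply/funext => w; rewrite indicE; congr (nat_of_bool _)%:R; apply/eqP/idP; rewrite inE.
Qed.

Lemma bmf_indY i k : bmf (fun w => (Y i w == k)%:R : R).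
Proof. by rewrite indicYE; exact: bmf_indic. Qed.

Lemma sum_indY c i w : \sum_k c k * (Y i w == k)%:R = c (Y i w).
Proof.
rewrite (bigD1 (Y i w))//= eqxx mulr1 big1 ?addr0// => k.
by rewrite eq_sym => /negbTE ->; rewrite mulr0.
Qed.

Lemma bmf_label c i : bmf (fun w => c (Y i w)).
Proof.
under eq_fun do rewrite -sum_indY.
by apply: bmf_sum => k; exact/bmfZ/bmf_indY.
Qed.

Lemma mean_label c i : E (fun w => c (Y i w)) = \sum_k c k * q k.
Proof.
under eq_fun do rewrite -sum_indY.
rewrite mean_sum//; last by move=> k; exact/bmfZ/bmf_indY.
apply: eq_bigr => k _; rewrite meanZ//; last exact: bmf_indY.
by rewrite indicYE mean_indic// PY.
Qed.

Lemma mean_label_indic c i j l : i != j ->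
  E (fun w => c (Y i w) * (Y j w == l)%:R) = (\sum_k c k * q k) * q l.
Proof.
move=> ij.
have -> : (fun w => c (Y i w) * (Y j w == l)%:R) =
   (fun w => \sum_k c k * ((Y i w == k)%:R * (Y j w == l)%:R)).
  by apply/funext => w; rewrite -sum_indY mulr_suml; apply: eq_bigr => k _; rewrite mulrA.
have bkl k : bmf (fun w => (Y i w == k)%:R * (Y j w == l)%:R : R).
  exact: bmfM (bmf_indY _ _) (bmf_indY _ _).
rewrite mean_sum//; last by move=> k; exact: bmfZ.
rewrite mulr_suml; apply: eq_bigr => k _; rewrite meanZ// -mulrA; congr (_ * _).
have -> : (fun w => (Y i w == k)%:R * (Y j w == l)%:R) =
    \1_[set w | Y i w = k /\ Y j w = l] :> (T -> R).
  apply/funext => w; rewrite indicE -natrM mulnb; congr (nat_of_bool _)%:R.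
  apply/andP/idP => [[/eqP yk /eqP yl]|]; rewrite inE //=.
  by case=> -> ->; rewrite !eqxx.
have mkl : measurable [set w | Y i w = k /\ Y j w = l].
  exact: (measurableI _ _ (mY i k) (mY j l)).
by rewrite mean_indic// PYY.
Qed.

Lemma mean_label2 c i j : i != j ->
  E (fun w => c (Y i w) * c (Y j w)) = (\sum_k c k * q k) ^+ 2.
Proof.
move=> ij.
have -> : (fun w => c (Y i w) * c (Y j w)) =
   (fun w => \sum_l c l * (c (Y i w) * (Y j w == l)%:R)).
  apply/funext => w; rewrite -[X in _ * X]sum_indY mulr_sumr.
  by apply: eq_bigr => k _; rewrite mulrCA.
have bl l : bmf (fun w => c (Y i w) * (Y j w == l)%:R : R).
  exact: bmfM (bmf_label _ _) (bmf_indY _ _).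
rewrite mean_sum//; last by move=> k; exact: bmfZ.
rewrite expr2 mulr_sumr; apply: eq_bigr => l _.
by rewrite meanZ// mean_label_indic// mulrCA.
Qed.

(** A linear statistic of the deviations of the frequencies of the labels
    [Y 0, ..., Y N.-1] from their probabilities [q]. *)
Definition count_dev N c w : R :=
  \sum_k c k * ((\sum_(i < N) (Y i w == k)%:R) / N%:R - q k).

Lemma count_devE N c w : (0 < N)%N ->
  count_dev N c w = N%:R^-1 * \sum_(i < N) (c (Y i w) - \sum_k c k * q k).
Proof.
move=> N0; have n0 : N%:R != 0 :> R by rewrite pnatr_eq0 -lt0n.
set M := \sum_k c k * q k.
rewrite sumrB sumr_const card_ord -[M *+ N]mulr_natl [RHS]mulrBr mulKf// /count_dev.
under eq_bigr do rewrite mulrBr mulrA mulr_sumr.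
rewrite sumrB -mulr_suml exchange_big /= mulrC; congr (_ * _ - _).
by apply: eq_bigr => i _; exact: sum_indY.
Qed.

Lemma bmf_count_dev N c : (0 < N)%N -> bmf (count_dev N c).
Proof.
move=> N0; rewrite (_ : count_dev N c = fun w => N%:R^-1 * \sum_(i < N) (c (Y i w) + - \sum_k c k * q k)).
  by apply/bmfZ/bmf_sum => i; apply: bmfD; [exact: bmf_label|exact: bmf_cst].
by apply/funext => w; rewrite count_devE.
Qed.

(** The statistic is a mean of [N] centred variables that are pairwise
    uncorrelated; the variance of each one is at most its second moment. *)
Lemma mean_count_dev_sqr N c : (0 < N)%N ->
  E (fun w => count_dev N c w ^+ 2) <= (\sum_k c k ^+ 2 * q k) / N%:R.
Proof.
move=> N0; have n0 : 0 < N%:R :> R by rewrite ltr0n.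
set M := \sum_k c k * q k; set V := \sum_k c k ^+ 2 * q k.
pose v i w := c (Y i w) + - M.
have bv i : bmf (v i) by apply: bmfD; [exact: bmf_label|exact: bmf_cst].
have -> : (fun w => count_dev N c w ^+ 2) =
    (fun w => (N%:R^-1) ^+ 2 * \sum_(i < N) \sum_(j < N) v i w * v j w).
  apply/funext => w; rewrite count_devE// exprMn; congr (_ * _).
  by rewrite expr2 mulr_suml; apply: eq_bigr => i _; rewrite mulr_sumr.
have bvv i j : bmf (fun w => v i w * v j w) by exact: bmfM.
rewrite meanZ//; last by apply: bmf_sum => i; exact: bmf_sum.
rewrite mean_sum//; last by move=> i; exact: bmf_sum.
have Evv i j : E (fun w => v i w * v j w) = E (fun w => c (Y i w) * c (Y j w)) - M ^+ 2.
  have -> : (fun w => v i w * v j w) =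
     (fun w => (c (Y i w) * c (Y j w) + (- M * c (Y i w) + - M * c (Y j w))) + M ^+ 2).
    by apply/funext => w; rewrite /v; ring.
  have b1 := bmfZ (- M) (bmf_label c i); have b2 := bmfZ (- M) (bmf_label c j).
  have b3 := bmfM (bmf_label c i) (bmf_label c j).
  rewrite (meanD d1 (bmfD b3 (bmfD b1 b2)) (bmf_cst _ _)) (meanD d1 b3 (bmfD b1 b2)).
  rewrite (meanD d1 b1 b2) (meanZ d1 _ (bmf_label c i)) (meanZ d1 _ (bmf_label c j)).
  by rewrite (mean_cst d1) !mean_label -/M; ring.
have -> : \sum_(i < N) E (fun w => \sum_(j < N) v i w * v j w) = N%:R * (V - M ^+ 2).
  rewrite mulr_natl -[in RHS](card_ord N) -sumr_const; apply: eq_bigr => i _.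
  rewrite mean_sum// (bigD1 i)//= big1 ?addr0 => [|j ji].
    rewrite Evv; congr (_ - _); rewrite -[RHS](mean_label (fun k => c k ^+ 2) i).
    by [].
  by rewrite Evv mean_label2 ?subrr// eq_sym.
rewrite expr2 -mulrA mulKf ?gt_eqF// mulrC ler_pM2r ?invr_gt0//.
by rewrite gerBl sqr_ge0.
Qed.

Lemma markov_bounded (f : T -> R) (t : R) : bmf f -> (forall w, 0 <= f w) -> 0 < t ->
  measurable [set w | t < f w] /\ (P [set w | (t < f w)%R] <= (E f / t)%R%:E)%E.
Proof.
move=> bf f0 t0.
have mA : measurable [set w | t < f w].
  have [mf _] := bf; have := mf measurableT `]t, +oo[%classic (measurable_itv _).
  rewrite setTI (_ : _ @^-1` _ = [set w | t < f w])//.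
  by apply/seteqP; split => w /=; rewrite in_itv/= andbT.
split=> //; rewrite -[P _]fineK ?fin_num_measure// lee_fin -mean_indic//.
rewrite ler_pdivlMr// mulrC -meanZ//; last exact: bmf_indic.
apply: le_mean => //; first exact/bmfZ/bmf_indic.
move=> w; rewrite indicE; have [|_] := boolP (w \in _); last by rewrite mulr0.
by rewrite inE /= mulr1 => /ltW.
Qed.

End multinomial.

Section discounted_sum.
Context {R : realType}.
Variables (n : nat) (h : R).
Implicit Types k j : nat.

(** The weight of the deviation of index [k] in the discounted sum of index [j]. *)
Definition discount j k : R := if (k <= j)%N then (1 - h ^+ 3) ^+ (j - k) else 0.

Hypotheses (h0 : 0 < h) (h1 : h <= 1).
Let l0 : 0 < h ^+ 3. Proof. exact: exprn_gt0. Qed.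
Let l1 : h ^+ 3 <= 1. Proof. by rewrite exprn_ile1// ltW. Qed.
Let r0 : 0 <= 1 - h ^+ 3. Proof. by rewrite subr_ge0. Qed.
Let r1 : 1 - h ^+ 3 <= 1. Proof. by rewrite gerBl ltW. Qed.

Lemma discount_itv j k : 0 <= discount j k <= 1.
Proof. by rewrite /discount; case: ifP => _; rewrite ?lexx ?ler01// exprn_ge0//= exprn_ile1. Qed.

Lemma discount_rec j k :
  discount j k - (1 - h ^+ 3) * (if j is j'.+1 then discount j' k else 0) = (k == j)%:R.
Proof.
rewrite /discount; case: j => [|j]; first by rewrite leqn0 mulr0 subr0; case: k => [|k]; rewrite ?expr0.
case: (ltngtP k j.+1) => [kj|kj|->].
- by rewrite -ltnS kj subSn// exprS subrr.
- by rewrite leqNgt (ltn_trans _ kj)//= mulr0 subrr.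
- by rewrite ltnn mulr0 subr0 subnn.
Qed.

(** A geometric series of ratio [1 - h^3]; squares are dominated by the weights
    themselves, which are at most 1. *)
Lemma discount_sum_le k (N : nat) : h ^+ 3 * \sum_(j < N) discount j k ^+ 2 <= 1.
Proof.
have H : h ^+ 3 * \sum_(j < N) discount j k <= 1 - (if (k <= N)%N then (1 - h ^+ 3) ^+ (N - k) else 1).
  elim: N => [|N IH].
    by rewrite big_ord0 mulr0 leqn0; case: k => [|k]; rewrite ?subrr.
  rewrite big_ord_recr /= mulrDr; apply: le_trans (lerD IH (lexx _)) _.
  rewrite /discount; case: (ltngtP k N.+1) => [kN|kN|->].
  - have kN' : (k <= N)%N by [].
    by rewrite kN' subSn// [_ ^+ (N - k).+1]exprS le_eqVlt; apply/orP; left; apply/eqP; ring.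
  - by rewrite leqNgt (ltn_trans _ kN)//= mulr0 addr0.
  - by rewrite ltnn subnn mulr0 addr0.
apply: le_trans (_ : h ^+ 3 * \sum_(j < N) discount j k <= _).
  rewrite ler_wpM2l ?(ltW l0)//; apply: ler_sum => j _.
  by have /andP[p0 p1] := discount_itv j k; rewrite expr2 ler_piMr.
apply: le_trans H _; rewrite gerBl; case: ifP => // _; exact: exprn_ge0.
Qed.

End discounted_sum.

(** * The L1 rate of the mixture density *)

Section L1_rate.
Context {R : realType} (a b : R) (a0 : 0 < a) (b0 : 0 < b).
Notation RT := (measurableTypeR R).
Notation mu := (@lebesgue_measure R).
Variables (g0 : probability RT R).
Hypothesis cg0 : carried a g0.
Context (d : measure_display) (Omega : measurableType d) (P : probability Omega R).
Variable X : nat -> Omega -> R.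
Hypothesis mX : forall i (B : set RT), measurable B -> measurable (X i @^-1` B).
Hypothesis X_law : forall i (B : set RT), measurable B ->
  P (X i @^-1` B) = (\int[mu]_x (\1_B x * mixture_pdf a b g0 x)%:E)%E.
Hypothesis X_indep : forall i j (B C : set RT), i != j -> measurable B -> measurable C ->
  P (X i @^-1` B `&` X j @^-1` C) = (P (X i @^-1` B) * P (X j @^-1` C))%E.

Lemma L1_normE (g : probability RT R) : carried a g ->
  ('N[mu]_1 [EFin \o (mixture_pdf a b g \- mixture_pdf a b g0)%R] =
   (\int[mu]_x `|mixture_pdf a b g x - mixture_pdf a b g0 x|)%:E)%E.
Proof.
move=> cg; rewrite Lnorm1 /Rintegral fineK//.
have iD := integrableB measurableT (density_integrable (mixture_density b0 cg))
  (density_integrable (mixture_density b0 cg0)).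
exact: (@integrable_fin_num _ _ _ mu _ measurableT _ (integrable_abse iD)).
Qed.

Section fixed_size.
Variables (p : nat) (h : R).
Hypotheses (h0 : 0 < h) (h1 : h <= 1) (nh : p.+1%:R * h ^+ 4 = 1).

Let Y i w : 'I_p.+1 := cell a p (X i w).
Let q k : R := cell_mass a b g0 (p := p) k.

Lemma measurable_label i k : measurable [set w | Y i w = k].
Proof. exact: mX (measurable_cell a0 k). Qed.

Lemma P_label i k : P [set w | Y i w = k] = (q k)%:E.
Proof.
have dm0 := mixture_density b0 cg0.
have bk := bmf_cell a0 k.
rewrite [LHS](X_law i (measurable_cell a0 k)) /q /cell_mass /mean /Rintegral fineK.
  apply: eq_integral => x _; congr EFin; rewrite mulrC indicE; congr (_ * (nat_of_bool _)%:R).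
  by apply/idP/eqP; rewrite inE.
exact: (@integrable_fin_num _ _ _ mu _ measurableT _ (bmf_int dm0 bk)).
Qed.

Lemma P_label2 i j k l : i != j -> P [set w | Y i w = k /\ Y j w = l] = (q k * q l)%:E.
Proof.
move=> ij; have := X_indep ij (measurable_cell a0 k) (measurable_cell a0 l).
by rewrite EFinM -(P_label i k) -(P_label j l).
Qed.

Definition smooth_dev j w : R :=
  count_dev Y q p.+1 (fun k : 'I_p.+1 => discount h j k) w.

Lemma smooth_dev_rec (k : 'I_p.+1) w : freq_dev a b g0 (fun i => X i w) k =
  smooth_dev k w - (1 - h ^+ 3) * (if (k : nat) is j.+1 then smooth_dev j w else 0).
Proof.
pose r : 'I_p.+1 -> R := fun l => (\sum_(i < p.+1) (Y i w == l)%:R) / p.+1%:R - q l.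
have E j : smooth_dev j w = \sum_(l < p.+1) discount h j l * r l by [].
have -> : (if (k : nat) is j.+1 then smooth_dev j w else 0) =
   \sum_(l < p.+1) (if (k : nat) is j.+1 then discount h j l else 0) * r l.
  by case: (k : nat) => [|j] //; rewrite big1// => l _; rewrite mul0r.
rewrite E mulr_sumr -sumrB.
under eq_bigr do rewrite mulrA -mulrBl discount_rec.
rewrite (bigD1 k)//= eqxx mul1r big1 ?addr0// => l lk.
by rewrite (negbTE (_ : (l : nat) != k)) ?mul0r.
Qed.

Definition dev_energy w : R :=
  h ^+ 3 * \sum_(j < p.+1) smooth_dev j w ^+ 2 + smooth_dev p w ^+ 2.

(** Each [smooth_dev j] has variance at most [h^4] times the sum of
    [discount j k ^+ 2 * q k].  Summing over [j] first, [discount_sum_le]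
    compensates the factor [h^3], and the [q k] add up to 1. *)
Lemma mean_dev_energy : mean P (fun=> 1) dev_energy <= 2 * h ^+ 4.
Proof.
have n0 : 0 < p.+1%:R :> R by rewrite ltr0n.
have hn : h ^+ 4 = p.+1%:R^-1.
  by apply: (mulfI (lt0r_neq0 n0)); rewrite nh divff// gt_eqF.
have dP := @one_density _ _ _ P.
have bS j : bmf (fun w => smooth_dev j w ^+ 2).
  by apply/bmf_sqr/bmf_count_dev => //; exact: measurable_label.
have bSS : bmf (fun w => \sum_(j < p.+1) smooth_dev j w ^+ 2) by exact: bmf_sum.
rewrite /dev_energy (meanD dP (bmfZ _ bSS) (bS p)) (meanZ dP _ bSS) (mean_sum dP)//.
have V j : mean P (fun=> 1) (fun w => smooth_dev j w ^+ 2) <=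
    (\sum_(k < p.+1) discount h j k ^+ 2 * q k) * h ^+ 4.
  rewrite hn; apply: mean_count_dev_sqr => //.
  - exact: measurable_label.
  - exact: P_label.
  - by move=> *; exact: P_label2.
have q0 k : 0 <= q k by exact: cell_mass_ge0.
have q1 : \sum_(k < p.+1) q k = 1 by exact: cell_mass_sum.
have h40 : 0 <= h ^+ 4 by rewrite exprn_ge0// ltW.
have h30 : 0 <= h ^+ 3 by rewrite exprn_ge0// ltW.
rewrite [2 * _](_ : _ = h ^+ 4 + h ^+ 4); last by ring.
apply: lerD.
  apply: le_trans (_ : h ^+ 3 * \sum_(j < p.+1)
     (\sum_(k < p.+1) discount h j k ^+ 2 * q k) * h ^+ 4 <= _).
    by rewrite ler_wpM2l//; apply: ler_sum => j _.
  rewrite -mulr_suml exchange_big /= mulrA -[X in _ <= X]mul1r ler_wpM2r// -q1.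
  rewrite mulr_sumr; apply: ler_sum => k _.
  rewrite -mulr_suml mulrA -[X in _ <= X]mul1r ler_wpM2r//.
  exact: discount_sum_le.
apply: le_trans (V p) _; rewrite -[X in _ <= X]mul1r ler_wpM2r// -q1.
apply: ler_sum => k _; rewrite -[X in _ <= X]mul1r ler_wpM2r//.
by have /andP[z0 z1] := discount_itv h0 h1 p k; rewrite exprn_ile1.
Qed.

(** Off the event where [dev_energy] exceeds [T * h^4], of probability at most
    [2 / T] by Markov's inequality, [llr_sq_le] applies to every maximizer. *)
Lemma L1_deviation (ghat : Omega -> probability RT R) (T : R) : 0 < T ->
  (forall w, is_npmle a b p.+1 (fun i => X i w) (ghat w)) ->
  (mu_ext P [set w | (expR (llr_range a b) * ((1 + llr_sq_c a b T) / 2) * Num.sqrt (h ^+ 3))%:E <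
     'N[mu]_1 [EFin \o (mixture_pdf a b (ghat w) \- mixture_pdf a b g0)%R]] <= (2 / T)%:E)%E.
Proof.
move=> T0 npmle.
have h40 : 0 < h ^+ 4 by rewrite exprn_gt0.
have h30 : 0 < h ^+ 3 by rewrite exprn_gt0.
have bW : bmf dev_energy.
  have bS j : bmf (fun w => smooth_dev j w ^+ 2).
    by apply/bmf_sqr/bmf_count_dev => //; exact: measurable_label.
  exact: bmfD (bmfZ _ (bmf_sum _)) (bS p).
have W0 w : 0 <= dev_energy w.
  by rewrite addr_ge0 ?sqr_ge0// mulr_ge0 ?(ltW h30)// sumr_ge0// => j _; exact: sqr_ge0.
have [mA PA] := @markov_bounded _ _ _ P _ _ bW W0 (mulr_gt0 T0 h40).
apply: le_trans (_ : P [set w | (T * h ^+ 4 < dev_energy w)%R] <= _)%E; last first.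
  apply: le_trans PA _; rewrite lee_fin ler_pdivrMr ?mulr_gt0//.
  apply: le_trans mean_dev_energy _.
  by rewrite le_eqVlt; apply/orP; left; apply/eqP; field; rewrite gt_eqF.
rewrite -(measurable_mu_extE P mA).
apply: le_mu_ext => w /=; rewrite ltNge; apply: contraPlt => /= Ww.
have [cg max_g] := npmle w.
have J := llr_sq_le a0 b0 cg0 cg (max_g _ cg0) (ltW T0) h0 h1 nh
  (fun k => smooth_dev_rec k w) Ww.
set s := Num.sqrt (h ^+ 3).
have s0 : 0 < s by rewrite sqrtr_gt0.
have s2 : s ^+ 2 = h ^+ 3 by rewrite sqr_sqrtr// ltW.
apply/negP; rewrite negbK (L1_normE cg) lee_fin; apply: le_trans (L1_le_llr_sq a0 b0 cg0 cg s0) _.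
rewrite -mulrA ler_wpM2l ?expR_ge0// -lerBrDl ler_pdivrMr ?mulr_gt0//.
apply: le_trans J _; rewrite -s2.
by rewrite le_eqVlt; apply/orP; left; apply/eqP; field.
Qed.

End fixed_size.
End L1_rate.

(** * Testing Lipschitz functions against the mixtures *)

Section smoothing.
Context {R : realType} (a b : R) (a0 : 0 < a) (b0 : 0 < b).
Notation RT := (measurableTypeR R).
Notation mu := (@lebesgue_measure R).
Implicit Types (g h : probability RT R) (f : RT -> R) (s t x y c C : R).
Notation lap t := (fun y : RT => laplace_pdf b (y - t)).

Lemma laplace_density t : density mu (lap t).
Proof.
split.
- by apply: measurable_laplace_shift; exact: measurable_funB.
- by move=> x; rewrite ltW// laplace_gt0.
- rewrite (ge0_integral_shift (- t) (f := fun z => (laplace_pdf b z)%:E)).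
  + exact: integral_laplace.
  + by apply/measurable_EFinP; exact: measurable_laplace.
  + by move=> z; rewrite lee_fin ltW// laplace_gt0.
Qed.

Lemma bmf_shift f c : bmf f -> bmf (fun y => f (y + c)).
Proof.
move=> [mf [C fC]]; split; last by exists C => x.
by apply: measurableT_comp => //; exact: measurable_shift.
Qed.

Lemma mean_laplace_shift f c t : bmf f ->
  mean mu (lap t) (fun y => f (y + c)) = mean mu (lap (t + c)) f.
Proof.
move=> bf; have ms := @measurable_shift R c.
rewrite /mean /Rintegral; congr fine.
pose F y := (laplace_pdf b (y - (t + c)) * f y)%:E.
have iF : mu.-integrable [set: RT] F by exact: (bmf_int (laplace_density (t + c)) bf).
have iFs : mu.-integrable [set: RT] (F \o (fun y => y + c)).
  have := bmf_int (laplace_density t) (bmf_shift c bf).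
  congr (integrable _ _ _); apply/funext => y /=.
  by rewrite /F /=; congr (laplace_pdf b _ * _)%:E; ring.
transitivity (\int[mu]_y (F \o (fun y => (y + c)%R)) y)%E.
  by apply: eq_integral => y _ /=; rewrite /F; congr (laplace_pdf b _ * _)%:E; ring.
have [mF _] := integrableP _ _ _ iF.
rewrite -(integral_pushforward ms mF iFs measurableT).
by apply: eq_measure_integral => A mA _; exact: lebesgue_shift.
Qed.

(** Tonelli's theorem, after adding a constant to make the bounded function [f]
    nonnegative. *)
Lemma mean_mixture g f : carried a g -> bmf f ->
  bmf (fun t : RT => mean mu (lap t) f) /\
  mean mu (mixture_pdf a b g) f = mean g (fun=> 1) (fun t => mean mu (lap t) f).
Proof.
move=> cg; wlog f0 : f / forall y, 0 <= f y => [W bf|bf].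
  have [_ [C fC]] := bf.
  have bfC := bmfD bf (bmf_cst _ C).
  have f0 y : 0 <= f y + C by have := fC y; rewrite ler_norml; lra.
  have [bA EA] := W _ f0 bfC.
  have E t : mean mu (lap t) (fun y => f y + C) = mean mu (lap t) f + C.
    by rewrite (meanD (laplace_density t) bf (bmf_cst _ C)) (mean_cst (laplace_density t)).
  have bB : bmf (fun t : RT => mean mu (lap t) f).
    rewrite (_ : (fun _ => _) = (fun t => mean mu (lap t) (fun y => f y + C) + - C)).
      exact: bmfD bA (bmf_cst _ _).
    by apply/funext => t; rewrite E addrK.
  split; [exact: bB|apply: (addIr C)].
  have dm := mixture_density b0 cg; have dg := @one_density _ _ _ g.
  rewrite -[X in _ + X = _](mean_cst dm) -(meanD dm bf (bmf_cst _ C)) EA.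
  rewrite -[X in _ = _ + X](mean_cst dg) -(meanD dg bB (bmf_cst _ C)).
  by congr (mean _ _ _); apply/funext => t; rewrite E.
have [mf [C fC]] := bf.
have ft0 t y : 0 <= laplace_pdf b (y - t) * f y by rewrite mulr_ge0// ltW// laplace_gt0.
have fin t : ((mean mu (lap t) f)%:E = \int[mu]_y (f y * laplace_pdf b (y - t))%:E)%E.
  rewrite /mean /Rintegral fineK.
    by apply: eq_integral => y _; rewrite mulrC.
  exact: (@integrable_fin_num _ _ _ mu _ measurableT _ (bmf_int (laplace_density t) bf)).
pose k := fun z : RT * RT => (f z.1 * laplace_pdf b (z.1 - z.2))%:E.
have mk : measurable_fun setT k.
  apply/measurable_EFinP; apply: measurable_funM.
    by apply: measurableT_comp => //; exact: measurable_fst.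
  by apply/measurable_laplace_shift => //; apply: measurable_funB.
have k0 z : (0 <= k z)%E by rewrite lee_fin mulr_ge0// ltW// laplace_gt0.
have bA : bmf (fun t : RT => mean mu (lap t) f).
  split.
    apply/measurable_EFinP.
    rewrite (_ : _ \o _ = fubini_G mu k).
      exact: (@measurable_fun_fubini_tonelli_G _ _ RT RT R mu k mk k0).
    by apply/funext => t; exact: fin.
  exists C => t; rewrite ger0_norm; last by apply: Rintegral_ge0 => y _; exact: ft0.
  rewrite -[X in _ <= X](mean_cst (laplace_density t)).
  apply: (le_mean (laplace_density t) bf (bmf_cst _ C)) => y.
  exact: le_trans (ler_norm _) (fC y).
split=> //.
rewrite /mean /Rintegral; congr fine.
transitivity (\int[mu]_y (f y * mixture_pdf a b g y)%:E)%E.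
  by apply: eq_integral => y _; rewrite mulrC.
rewrite mixture_tonelli//; apply: eq_integral => t _.
by rewrite mul1r -fin.
Qed.

Definition cosh2 s : R := expR (s / b) + expR (- (s / b)).

Lemma cosh2_gt s : 0 < s -> (s / b) ^+ 2 / 4 <= cosh2 s - 2.
Proof.
move=> s0; set v := s / b / 2.
have v0 : 0 < v by rewrite !divr_gt0.
have -> : s / b = 2 * v by rewrite /v; field; rewrite gt_eqF.
rewrite /cosh2 (_ : s / b = 2 * v); last by rewrite /v; field; rewrite gt_eqF.
rewrite -mulrN !expRM_natl.
have h1 := expR_ge1Dx v; have h2 : expR v * expR (- v) = 1 by rewrite -expRD subrr expR0.
have h3 : expR (- v) <= 1 by rewrite expR_le1; lra.
have h4 := expR_gt0 (- v).
move: (expR v) (expR (- v)) h1 h2 h3 h4 => p q h1 h2 h3 h4.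
have -> : p ^+ 2 + q ^+ 2 - 2 = (p - q) ^+ 2 + 2 * (p * q - 1) by ring.
rewrite h2 subrr mulr0 addr0.
have : v <= p - q by lra.
nra.
Qed.

(** A finite difference version of the operator [1 - b^2 (d/dx)^2], of which the
    Laplace density is the Green function; the choice of the factor [cosh2 s] makes
    [spread s (laplace_pdf b)] vanish beyond distance [s], see [hat_eq0]. *)
Definition spread s f y : R := cosh2 s * f y - f (y + s) - f (y - s).

Lemma bmf_spread s f : bmf f -> bmf (spread s f).
Proof.
move=> bf.
have -> : spread s f = (fun y => (cosh2 s * f y + -1 * f (y + s)) + -1 * f (y - s)).
  by apply/funext => y; rewrite /spread; ring.
by apply: bmfD; [apply: bmfD|]; apply: bmfZ => //; exact: bmf_shift.
Qed.

(** The operator [spread s] is symmetric, so that it can be moved from the test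
    function to the Laplace density. *)
Lemma mean_spread s f t : bmf f ->
  mean mu (lap t) (spread s f) =
  \int[mu]_y (spread s (laplace_pdf b) (y - t) * f y).
Proof.
move=> bf.
have b1 := bmf_shift s bf; have b2 := bmf_shift (- s) bf.
have -> : spread s f = (fun y => (cosh2 s * f y + -1 * f (y + s)) + -1 * f (y - s)).
  by apply/funext => y; rewrite /spread; ring.
have dt := laplace_density t.
have z0 := bmfZ (cosh2 s) bf; have z1 := bmfZ (-1) b1; have z2 := bmfZ (-1) b2.
rewrite (meanD dt (bmfD z0 z1) z2) (meanD dt z0 z1).
rewrite (meanZ dt _ bf) (meanZ dt _ b1) (meanZ dt _ b2) !mean_laplace_shift//.
have i0 := bmf_int dt z0.
have i1 := bmf_int (laplace_density (t + s)) (bmfZ (-1) bf).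
have i2 := bmf_int (laplace_density (t - s)) (bmfZ (-1) bf).
rewrite -(meanZ dt _ bf) -(meanZ (laplace_density (t + s)) _ bf) -(meanZ (laplace_density (t - s)) _ bf).
rewrite /mean -RintegralD//.
rewrite -RintegralD//; last exact: (integrableD measurableT i0 i1).
apply: eq_Rintegral => y _; rewrite /spread.
have -> : y - t + s = y - (t - s) by ring.
have -> : y - t - s = y - (t + s) by ring.
move: (laplace_pdf b) => L; ring.
Qed.

Lemma hat_ge0 s z : 0 <= s -> 0 <= spread s (laplace_pdf b) z.
Proof. by move=> s0; rewrite /spread; have := laplace_semiconvex b0 z s0; rewrite /cosh2; lra. Qed.

Lemma hat_eq0 s z : 0 <= s -> s <= `|z| -> spread s (laplace_pdf b) z = 0.
Proof.
move=> s0 sz.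
have W x : s <= x -> spread s (laplace_pdf b) x = 0.
  move=> sx; rewrite /spread /cosh2 /laplace_pdf !ger0_norm; try lra.
  have -> : - (x + s) / b = - (s / b) + - x / b by field; rewrite gt_eqF.
  have -> : - (x - s) / b = s / b + - x / b by field; rewrite gt_eqF.
  rewrite !expRD; move: (expR _) (expR _) (expR _) (2 * b)^-1 => u v w k; ring.
have [z0|z0] := leP 0 z; first by apply: W; move: sz; rewrite ger0_norm.
rewrite -(W (- z)); last by move: sz; rewrite ltr0_norm.
rewrite /spread laplaceN -[laplace_pdf b (z + s)]laplaceN -[laplace_pdf b (z - s)]laplaceN.
by rewrite !opprD opprK; ring.
Qed.

Lemma spread_cst s c : spread s (fun=> c) = fun=> (cosh2 s - 2) * c.
Proof. by apply/funext => y; rewrite /spread; ring. Qed.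

Lemma hat_mass s t : \int[mu]_y (spread s (laplace_pdf b) (y - t)) = cosh2 s - 2.
Proof.
have := mean_spread s t (bmf_cst _ 1).
rewrite spread_cst (mean_cst (laplace_density t)) mulr1 => ->.
by apply: eq_Rintegral => y _; rewrite mulr1.
Qed.

Lemma hat_integrable s t : mu.-integrable setT (EFin \o (fun y => spread s (laplace_pdf b) (y - t))).
Proof.
have b1 := bmf_cst RT (1 : R).
have i0 := bmf_int (laplace_density t) (bmf_cst RT (cosh2 s)).
have i1 := bmf_int (laplace_density (t - s)) (bmf_cst RT (-1)).
have i2 := bmf_int (laplace_density (t + s)) (bmf_cst RT (-1)).
have := integrableD measurableT (integrableD measurableT i0 i1) i2.
congr (integrable _ _ _); apply/funext => y /=; rewrite -!EFinD; congr EFin; rewrite /spread.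
have -> : y - t + s = y - (t - s) by ring.
have -> : y - t - s = y - (t + s) by ring.
move: (laplace_pdf b) => L; ring.
Qed.

(** The hat [spread s (laplace_pdf b)] is nonnegative, supported in [-s, s], and of
    mass [cosh2 s - 2]: convolving with it averages [f] over a window of size [s]. *)
Lemma spread_approx s f t : 0 < s -> bmf f ->
  (forall x y, `|f x - f y| <= `|x - y|) ->
  `|mean mu (lap t) (spread s f) - (cosh2 s - 2) * f t| <= (cosh2 s - 2) * s.
Proof.
move=> s0 bf lf.
pose f0 y := f y + - f t.
have bf0 : bmf f0 by exact: bmfD bf (bmf_cst _ _).
have -> : mean mu (lap t) (spread s f) - (cosh2 s - 2) * f t = mean mu (lap t) (spread s f0).
  rewrite (_ : spread s f0 = (fun y => spread s f y + - ((cosh2 s - 2) * f t))).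
    have dt := laplace_density t.
    by rewrite (meanD dt (bmf_spread s bf) (bmf_cst _ _)) (mean_cst dt).
  by apply/funext => y; rewrite /spread /f0; ring.
rewrite mean_spread// -(hat_mass s t).
have ih := hat_integrable s t.
have ihf : mu.-integrable setT (EFin \o (fun y => spread s (laplace_pdf b) (y - t) * f0 y)).
  have [mf0 [C fC]] := bf0.
  have := integrableZl measurableT C ih; apply: le_integrable => //.
    have [mh _] := integrableP _ _ _ ih.
    by apply/measurable_EFinP/measurable_funM => //; exact/measurable_EFinP.
  move=> y _ /=; rewrite lee_fin !normrM mulrC ler_wpM2r//.
  by apply: le_trans (fC y) (ler_norm _).
rewrite -RintegralZr//.
apply: le_trans (le_normr_Rintegral measurableT ihf) _.
apply: le_Rintegral => //.
- exact: (integrable_abse ihf).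
- by have := integrableZl measurableT s ih; congr (integrable _ _ _); apply/funext => y /=; rewrite -EFinM mulrC.
move=> y _; rewrite normrM ger0_norm; last exact/hat_ge0/ltW.
have [sy|sy] := leP s `|y - t|.
  by rewrite hat_eq0 ?mul0r// ltW.
by rewrite ler_wpM2l ?hat_ge0 ?(ltW s0)//; apply: le_trans (lf y t) (ltW sy).
Qed.

(** By [spread_approx], up to [2 * s] the left-hand side is the integral of
    [spread s f / (cosh2 s - 2)] against the difference of the mixtures.  For a
    1-Lipschitz [f], [spread s f] differs from [(cosh2 s - 2) * f] by at most
    [2 * s], and [cosh2 s - 2] is of order [s^2], whence the factor of order
    [1 / s]. *)
Lemma dual_le_L1 g h s f C : carried a g -> carried a h -> 0 < s ->
  bmf f -> (forall x y, `|f x - f y| <= `|x - y|) -> (forall x, `|f x| <= C) ->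
  mean g (fun=> 1) f - mean h (fun=> 1) f <=
  2 * s + (C + 8 * b ^+ 2 / s) * \int[mu]_x `|mixture_pdf a b g x - mixture_pdf a b h x|.
Proof.
move=> cg ch s0 bf lf fC.
set c := cosh2 s - 2.
have c4 : (s / b) ^+ 2 / 4 <= c by exact: cosh2_gt.
have c0 : 0 < c by apply: lt_le_trans c4; rewrite divr_gt0// exprn_gt0// divr_gt0.
have bS := bmf_spread s bf.
have [bA Eg] := mean_mixture cg bS; have [_ Eh] := mean_mixture ch bS.
pose A t := mean mu (lap t) (spread s f).
have Ale t : A t <= c * f t + c * s /\ c * f t - c * s <= A t.
  by have := spread_approx t s0 bf lf; rewrite ler_norml -/c -/(A t); move=> /andP[]; split; lra.
have Eone (p : probability RT R) : density p (fun=> 1) := @one_density _ _ _ p.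
have up : c * mean g (fun=> 1) f - c * s <= mean g (fun=> 1) A.
  rewrite -(meanZ (Eone g) _ bf) -[X in _ - X](mean_cst (Eone g)) -mulN1r.
  rewrite -(meanZ (Eone g) _ (bmf_cst _ _)) -(meanD (Eone g) (bmfZ _ bf) (bmfZ _ (bmf_cst _ _))).
  apply: (le_mean (Eone g)) => //; first exact: bmfD (bmfZ _ bf) (bmfZ _ (bmf_cst _ _)).
  by move=> t; rewrite mulN1r; have [] := Ale t.
have lo : mean h (fun=> 1) A <= c * mean h (fun=> 1) f + c * s.
  rewrite -(meanZ (Eone h) _ bf) -[X in _ + X](mean_cst (Eone h)).
  rewrite -(meanD (Eone h) (bmfZ _ bf) (bmf_cst _ _)).
  apply: (le_mean (Eone h)) => //; first exact: bmfD (bmfZ _ bf) (bmf_cst _ _).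
  by move=> t; have [] := Ale t.
set I := \int[mu]_x _.
have I0 : 0 <= I by apply: Rintegral_ge0.
have main : mean g (fun=> 1) A - mean h (fun=> 1) A <= (c * C + 2 * s) * I.
  rewrite -Eg -Eh.
  have ig := bmf_int (mixture_density b0 cg) bS; have ih := bmf_int (mixture_density b0 ch) bS.
  rewrite /mean -RintegralB//.
  have iD := integrable_abse (integrableB measurableT (density_integrable (mixture_density b0 cg))
     (density_integrable (mixture_density b0 ch))).
  rewrite /I -RintegralZl//.
  apply: le_Rintegral => //.
  - exact: (integrableB measurableT ig ih).
  - exact: (integrableZl measurableT (c * C + 2 * s) iD).
  move=> x _; rewrite -mulrBl mulrC; apply: le_trans (ler_norm _) _.
  rewrite normrM ler_wpM2r//.
  rewrite (_ : spread s f x = c * f x + ((f x - f (x + s)) + (f x - f (x - s)))); last first.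
    by rewrite /spread /c; ring.
  apply: le_trans (ler_normD _ _) _; apply: lerD.
    by rewrite normrM (ger0_norm (ltW c0)) ler_wpM2l// ltW.
  apply: le_trans (ler_normD _ _) _.
  have := lf x (x + s); have := lf x (x - s).
  have -> : x - (x - s) = s :> R by ring.
  have -> : x - (x + s) = - s :> R by ring.
  rewrite normrN (ger0_norm (ltW s0)); lra.
rewrite -(ler_pM2l c0).
have : 2 * s * I <= c * (8 * b ^+ 2 / s) * I.
  rewrite ler_wpM2r//.
  have -> : 2 * s = (s / b) ^+ 2 / 4 * (8 * b ^+ 2 / s) by field; rewrite !gt_eqF.
  by rewrite ler_wpM2r// divr_ge0 ?mulr_ge0 ?sqr_ge0// ltW.
move: up lo main; move: (mean g (fun=> 1) A) (mean h (fun=> 1) A) => u v.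
move: (mean g _ f) (mean h _ f) => u' v'; lra.
Qed.

End smoothing.

(** * The quantile coupling and its Kantorovich potential *)

Section bundle.
Context d1 d2 (T1 : measurableType d1) (T2 : measurableType d2).

Definition mfun_of (f : T1 -> T2) (mf : measurable_fun [set: T1] f) : {mfun T1 >-> T2} :=
  MeasurableFun.Pack (MeasurableFun.Class (isMeasurableFun.Build _ _ _ _ _ mf)).

End bundle.

Section quantile.
Context {R : realType} (a : R) (a0 : 0 < a).
Notation RT := (measurableTypeR R).
Implicit Types (x y u v : R).

Lemma Naa : - a <= a. Proof. by have := a0; lra. Qed.

Section one_measure.
Variables (g : probability RT R).
Hypothesis cg : carried a g.

Definition distr_fun x : R := fine (g `]-oo, x]%classic).

Lemma distr_funE x : (g `]-oo, x]%classic = (distr_fun x)%:E)%E.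
Proof. by rewrite /distr_fun fineK// fin_num_measure//; exact: measurable_itv. Qed.

Lemma distr_fun_nondecreasing x y : x <= y -> distr_fun x <= distr_fun y.
Proof.
move=> xy; rewrite -lee_fin -!distr_funE le_measure// ?inE; try exact: measurable_itv.
exact: subitvPr.
Qed.

Lemma distr_fun_ge x : a <= x -> distr_fun x = 1.
Proof.
move=> ax; apply/EFin_inj; rewrite -distr_funE; apply/eqP; rewrite eq_le.
rewrite probability_le1 ?andTb; last exact: measurable_itv.
rewrite -(cg : g `[- a, a]%classic = 1%E) le_measure// ?inE; try exact: measurable_itv.
by move=> z /=; rewrite !in_itv/= => /andP[_ za]; exact: le_trans ax.
Qed.

Lemma distr_fun_lt x : x < - a -> distr_fun x = 0.
Proof.
move=> xa; apply/EFin_inj; rewrite -distr_funE; apply/eqP; rewrite eq_le measure_ge0 andbT.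
have mI : measurable (`[- a, a]%classic : set RT) by exact: measurable_itv.
have gC : g (~` `[- a, a]%classic) = 0%E.
  by have := @probability_setC _ _ _ g _ mI; rewrite (cg : g `[- a, a]%classic = 1%E) subee.
apply: (@le_trans _ _ (g (~` `[- a, a]%classic))); last by rewrite gC.
rewrite le_measure// ?inE; [exact: measurable_itv|exact: measurableC|].
by move=> z /=; rewrite !in_itv/= => zx /andP[az _]; have := le_lt_trans (le_trans az zx) xa; rewrite ltxx.
Qed.

Lemma distr_fun_le1 x : distr_fun x <= 1.
Proof. by rewrite -lee_fin -distr_funE probability_le1//; exact: measurable_itv. Qed.

Lemma distr_fun_ge0 x : 0 <= distr_fun x.
Proof. by rewrite -lee_fin -distr_funE measure_ge0. Qed.

Lemma distr_fun_right x u : (forall y, x < y -> u <= distr_fun y) -> u <= distr_fun x.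
Proof.
move=> H; rewrite -lee_fin -distr_funE (itvNycEbigcap true x).
pose F k : set RT := [set` Interval -oo%O (BSide true (x + k.+1%:R^-1))].
have mF k : measurable (F k) by exact: measurable_itv.
have FE : \bigcap_k F k = `]-oo, x]%classic by rewrite -itvNycEbigcap.
have cF : (g \o F) k @[k --> \oo] --> g (\bigcap_k F k).
  apply: nonincreasing_cvg_mu => //.
  - by rewrite (le_lt_trans (probability_le1 g (mF 0%N)))// ltry.
  - by rewrite FE; exact: measurable_itv.
  - move=> m n mn; apply/subsetPset/subset_itvl; rewrite bnd_simp lerD2l lef_pV2 ?posrE ?ltr0n//.
    by rewrite ler_nat.
apply: (cvge_ge _ cF); apply: nearW => k /=.
have k0 : 0 < k.+1%:R^-1 / 2 :> R by rewrite divr_gt0// invr_gt0.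
apply: (@le_trans _ _ (distr_fun (x + k.+1%:R^-1 / 2))%:E).
  by rewrite lee_fin H// ltrDl.
rewrite -distr_funE le_measure// ?inE; try exact: measurable_itv.
by apply: subset_itvl; rewrite bnd_simp ltrD2l; move: k.+1%:R^-1 k0 => z; lra.
Qed.

(** The superlevel set of the distribution function that defines the quantile of [u];
    intersecting with [-a, a] and capping [u] at 1 make it nonempty and bounded
    for every real [u]. *)
Definition level u : set R := [set x | - a <= x <= a /\ Num.min u 1 <= distr_fun x].
Definition quantile u : R := inf (level u).

Lemma level_has_inf u : has_inf (level u).
Proof.
split; last by exists (- a) => x [/andP[]].
exists a; split; first by rewrite Naa lexx.
by rewrite distr_fun_ge// ge_min lexx orbT.
Qed.

(** Right continuity of the distribution function: the infimum is attained. *)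
Lemma quantile_level u : level u (quantile u).
Proof.
have [ne lb] := level_has_inf u.
have ge_a : - a <= quantile u by apply: lb_le_inf => // x [/andP[]].
have in_a : level u a by split; [rewrite Naa lexx|rewrite distr_fun_ge// ge_min lexx orbT].
split; first by rewrite ge_a /=; exact: ge_inf.
apply: distr_fun_right => y qy.
have yq : 0 < y - quantile u by rewrite subr_gt0.
have [x [_ ux] xy] := inf_adherent yq (level_has_inf u).
apply: le_trans ux _; apply: distr_fun_nondecreasing; apply: ltW; apply: lt_le_trans xy _.
by rewrite addrC subrK.
Qed.

Lemma quantile_itv u : - a <= quantile u <= a.
Proof. by have [] := quantile_level u. Qed.

Lemma quantile_le u x : - a <= x <= a -> (quantile u <= x) = (Num.min u 1 <= distr_fun x).
Proof.
move=> xa; apply/idP/idP => [qx|ux].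
  by have [_ h] := quantile_level u; apply: le_trans h (distr_fun_nondecreasing qx).
by apply: ge_inf; [have [] := level_has_inf u|].
Qed.

Lemma quantile_nondecreasing u v : u <= v -> quantile u <= quantile v.
Proof.
move=> uv; rewrite quantile_le ?quantile_itv//.
by have [_] := quantile_level v; apply: le_trans; rewrite le_min !ge_min uv lexx orbT.
Qed.

Lemma measurable_quantile : measurable_fun [set: RT] (quantile : RT -> RT).
Proof. by apply: nondecreasing_measurable => // u v; exact: quantile_nondecreasing. Qed.

Notation unif := (uniform_prob (@ltr01 R)).

Lemma lebesgue_itv0 y : 0 <= y ->
  lebesgue_measure (`[0%R, y]%classic : set RT) = y%:E.
Proof.
move=> y0; have := @lebesgue_measure_itv R `[0, y]%R; rewrite /= lte_fin => E.
apply: etrans E _; case: ltP => y0'; first by rewrite -EFinB subr0.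
by congr EFin; apply/eqP; rewrite eq_le y0.
Qed.

Lemma uniform_le y : 0 <= y <= 1 -> unif [set u | Num.min u 1 <= y] = y%:E.
Proof.
move=> /andP[y0 y1]; rewrite /uniform_prob integral_uniform_pdf.
have [yE|yn] := eqVneq y 1.
  rewrite (_ : _ `&` _ = `[0, 1]%classic); last first.
    by apply/seteqP; split => u /=; [case|move=> u01; split=> //; rewrite yE ge_min lexx orbT].
  rewrite (eq_integral (fun=> 1%E)); last first.
    by move=> u; rewrite inE /= in_itv /= /uniform_pdf => ->; rewrite subr0 invr1.
  by rewrite integral_cst// mul1e yE; exact: lebesgue_itv0.
have y1' : y < 1 by rewrite lt_neqAle yn.
rewrite (_ : _ `&` _ = `[0, y]%classic); last first.
  apply/seteqP; split => u /=; rewrite !in_itv/= ge_min [1 <= y]leNgt y1' orbF.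
    by move=> [-> /andP[-> _]].
  by move=> /andP[-> uy]; split=> //; exact: le_trans y1.
rewrite (eq_integral (fun=> 1%E)); last first.
  move=> u; rewrite inE /= in_itv /= /uniform_pdf => /andP[-> uy].
  by rewrite (le_trans uy y1) subr0 invr1.
rewrite integral_cst// mul1e; exact: lebesgue_itv0.
Qed.

(** Inverse transform sampling: the two measures agree on half-lines by [quantile_le],
    hence on half-open intervals, hence on Borel sets. *)
Lemma quantile_law (B : set RT) : measurable B -> unif (quantile @^-1` B) = g B.
Proof.
move=> mB; pose m := image_measure unif measurable_quantile.
have ray x : m `]-oo, x]%classic = g `]-oo, x]%classic.
  rewrite distr_funE.
  have [xa|xa] := ltP x (- a).
    rewrite distr_fun_lt// /m image_measureE (_ : quantile @^-1` _ = set0) ?measure0//.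
    apply/seteqP; split => u //=; rewrite in_itv/= => qx.
    by have /andP[qa _] := quantile_itv u; have := lt_le_trans (le_lt_trans qx xa) qa; rewrite ltxx.
  have [ax|ax] := leP a x.
    rewrite distr_fun_ge// -[RHS](probability_setT unif); congr (unif _).
    apply/seteqP; split => u //= _; rewrite in_itv/=; have /andP[_ qa] := quantile_itv u.
    exact: le_trans qa ax.
  rewrite -(@uniform_le (distr_fun x)) ?distr_fun_ge0 ?distr_fun_le1//; congr (unif _).
  by apply/seteqP; split => u /=; rewrite in_itv/= quantile_le ?xa ?(ltW ax).
have oc (m' : {measure set RT -> \bar R}) x y : (m' `]-oo, y]%classic < +oo)%E -> x <= y ->
    m' `]x, y]%classic = (m' `]-oo, y]%classic - m' `]-oo, x]%classic)%E.
  move=> moo xy.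
  have := @measureD _ _ _ m' `]-oo, y]%classic `]-oo, x]%classic
    (measurable_itv _) (measurable_itv _) moo.
  rewrite (_ : _ `&` _ = `]-oo, x]%classic); last first.
    apply/seteqP; split => z /=; rewrite !in_itv/=; first by case.
    by move=> zx; split=> //; exact: le_trans zx xy.
  move=> <-; congr (m' _); apply/seteqP; split => z /=; rewrite !in_itv/=.
    by move=> /andP[xz zy]; split=> //; apply/negP; rewrite -ltNge.
  by move=> [-> /negP]; rewrite -ltNge => ->.
have foo (m' : probability RT R) x : (m' `]-oo, x]%classic < +oo)%E.
  by rewrite (le_lt_trans (probability_le1 m' (measurable_itv _)))// ltry.
rewrite -[LHS]/(m B).
apply: (@measure_unique _ R RT (@ocitv R) (fun k : nat => `](- k%:R), k%:R]%classic) _ _ _ _ m g) => //.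
- exact: ocitvI.
- by move=> k; exists (- k%:R, k%:R).
- exact: bigcup_itvT.
- move=> _ [[x y] _ <-] /=; have [xy|yx] := leP x y.
    have goo := foo g y.
    have moo : (m `]-oo, y]%classic < +oo)%E by rewrite ray.
    by have := oc m x y moo xy; rewrite !ray -(oc g x y goo xy).
  have e0 : `]x, y]%classic = set0 :> set RT by apply: set_itv_ge; rewrite bnd_simp -leNgt ltW.
  by rewrite -[LHS]/(m _) e0 !measure0.
- move=> k; apply: (le_lt_trans _ (foo g k%:R)); rewrite -ray.
  rewrite le_measure// ?inE; try exact: measurable_itv.
  exact: subset_itvr.
Qed.

End one_measure.

Variables (g h : probability RT R).
Hypotheses (cg : carried a g) (ch : carried a h).
Notation mu := (@lebesgue_measure R).
Notation unif := (uniform_prob (@ltr01 R)).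
Notation G := (distr_fun g).
Notation H := (distr_fun h).

(** The derivative of a Kantorovich potential for the transport of [g] onto [h] on
    the line, where mass moves to the right where [H < G] and to the left where
    [G < H]. *)
Definition sign_diff x : R := if H x < G x then 1 else if G x < H x then -1 else 0.

Lemma measurable_distr_fun (p : probability RT R) : measurable_fun [set: RT] (distr_fun p).
Proof. by apply: nondecreasing_measurable => // x y; exact: distr_fun_nondecreasing. Qed.

Lemma measurable_sign_diff : measurable_fun [set: RT] sign_diff.
Proof.
apply: measurable_fun_ifT => //.
  by apply: measurable_fun_ltr; exact: measurable_distr_fun.
by apply: measurable_fun_ifT => //; apply: measurable_fun_ltr; exact: measurable_distr_fun.
Qed.

Lemma sign_diff_le1 x : `|sign_diff x| <= 1.
Proof. by rewrite /sign_diff; case: ifP => _; [|case: ifP => _]; rewrite ?normrN ?normr1 ?normr0. Qed.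

Definition potential t : R := \int[mu]_(x in `[- a, t[%classic) sign_diff x.

Lemma itv_co_measure x y : x <= y -> mu (`[x, y[%classic : set RT) = (y - x)%:E.
Proof.
move=> xy; have := @lebesgue_measure_itv R `[x, y[%R; rewrite /= lte_fin => E.
apply: etrans E _; case: ltP => yx; first by rewrite -EFinB.
by congr EFin; apply/eqP; rewrite eq_sym subr_eq0 eq_le xy yx.
Qed.

Lemma sign_diff_integrable x y : x <= y -> mu.-integrable `[x, y[%classic (EFin \o sign_diff).
Proof.
move=> xy; apply: measurable_bounded_integrable => //.
- by apply: (@le_lt_trans _ _ (y - x)%:E); rewrite ?ltry// -itv_co_measure.
- by apply: measurable_funTS; exact: measurable_sign_diff.
- exists 1; split=> [|M M1 z _]; first exact: num_real.
  by apply: le_trans (sign_diff_le1 z) (ltW M1).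
Qed.

Lemma potentialB x y : - a <= x -> x <= y ->
  potential y - potential x = \int[mu]_(z in `[x, y[%classic) sign_diff z.
Proof.
move=> ax xy; rewrite /potential.
have E : `[- a, y[%classic = `[- a, x[%classic `|` `[x, y[%classic :> set RT.
  apply/seteqP; split => z /=; rewrite !in_itv/=.
    by move=> /andP[az zy]; have [xz|zx] := leP x z; [right|left]; rewrite ?az// xz.
  by move=> [/andP[az zx]|/andP[xz zy]]; rewrite ?az ?zy ?(lt_le_trans zx xy) ?(le_trans ax xz).
rewrite E Rintegral_setU//.
- by rewrite addrC addKr.
- by rewrite -E; apply: sign_diff_integrable; exact: le_trans ax xy.
- apply/disj_setPS => z /= [] ; rewrite !in_itv/= => /andP[_ zx] /andP[xz _].
  by have := le_lt_trans xz zx; rewrite ltxx.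
Qed.

Lemma potential_lip x y : - a <= x -> - a <= y -> `|potential x - potential y| <= `|x - y|.
Proof.
wlog xy : x y / x <= y => [W ax ay|ax _].
  by have [/W->//|/ltW/W] := leP x y; rewrite distrC [`|x - y|]distrC; apply.
rewrite distrC potentialB// [`|x - y|]distrC [X in _ <= X]ger0_norm ?subr_ge0//.
have mI : measurable (`[x, y[%classic : set RT) by exact: measurable_itv.
apply: le_trans (le_normr_Rintegral mI (sign_diff_integrable xy)) _.
have E : \int[mu]_(z in `[x, y[%classic) 1 = y - x.
  by rewrite Rintegral_cst// mul1r; exact: (congr1 fine (itv_co_measure xy)).
rewrite -E; apply: le_Rintegral => //.
- exact: (integrable_abse (sign_diff_integrable xy)).
- apply: measurable_bounded_integrable => //.
    by apply: (@le_lt_trans _ _ (y - x)%:E); rewrite ?ltry// -itv_co_measure.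
  by exists 1; split=> [|M M1 z _]; [exact: num_real|rewrite normr1 ltW].
- by move=> z _; exact: sign_diff_le1.
Qed.

(** Between the two quantiles of [u] the level [u] separates [G] and [H], so that
    [sign_diff] has a constant sign there. *)
Lemma quantile_dist u :
  `|quantile g u - quantile h u| = potential (quantile h u) - potential (quantile g u).
Proof.
have /andP[ga ag] := quantile_itv cg u; have /andP[ha ah] := quantile_itv ch u.
have [gh|hg] := leP (quantile g u) (quantile h u).
  rewrite potentialB// ler0_norm ?subr_le0// opprB.
  have mI : measurable (`[quantile g u, quantile h u[%classic : set RT) by exact: measurable_itv.
  rewrite (@eq_Rintegral _ _ _ mu _ (fun=> 1 : R)).
    by rewrite Rintegral_cst// mul1r; symmetry; exact: (congr1 fine (itv_co_measure gh)).
  move=> x; rewrite inE /= in_itv/= => /andP[gx xh].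
  have xa : - a <= x <= a by rewrite (le_trans ga gx) (le_trans (ltW xh) ah).
  have uG : Num.min u 1 <= G x by rewrite -(quantile_le cg u xa).
  have uH : H x < Num.min u 1 by rewrite ltNge -(quantile_le ch u xa) -ltNge.
  by rewrite /sign_diff (lt_le_trans uH uG).
rewrite -[RHS]opprB potentialB ?(ltW hg)// ger0_norm ?subr_ge0 ?(ltW hg)//.
have mI : measurable (`[quantile h u, quantile g u[%classic : set RT) by exact: measurable_itv.
rewrite (@eq_Rintegral _ _ _ mu _ (fun=> -1 : R)).
  rewrite Rintegral_cst// -mulNr [- -1]opprK mul1r; apply: esym.
  exact: (congr1 fine (itv_co_measure (ltW hg))).
move=> x; rewrite inE /= in_itv/= => /andP[hx xg].
have xa : - a <= x <= a by rewrite (le_trans ha hx) (le_trans (ltW xg) ag).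
have uH : Num.min u 1 <= H x by rewrite -(quantile_le ch u xa).
have uG : G x < Num.min u 1 by rewrite ltNge -(quantile_le cg u xa) -ltNge.
by rewrite /sign_diff ltNge (ltW (lt_le_trans uG uH)) /= (lt_le_trans uG uH).
Qed.

Definition clip t : R := Num.max (- a) (Num.min t a).

Lemma clip_itv t : - a <= clip t <= a.
Proof. by rewrite /clip le_max lexx /= ge_max Naa ge_min lexx orbT. Qed.

Lemma clip_id t : - a <= t <= a -> clip t = t.
Proof. by move=> /andP[at_ ta]; rewrite /clip (min_idPl ta); apply/max_idPr. Qed.

Lemma clip_lip x y : `|clip x - clip y| <= `|x - y|.
Proof.
wlog xy : x y / x <= y => [W|].
  by have [/W//|/ltW/W] := leP x y; rewrite distrC [`|x - y|]distrC.
have := Naa; rewrite distrC [`|x - y|]distrC /clip => Na.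
case: (leP x a) => xa; case: (leP y a) => ya; case: (leP (- a) x) => ax;
  case: (leP (- a) y) => ay; case: (leP (- a) a) => aa; rewrite ?ler_norml ?ger0_norm;
  try (apply/andP; split); lra.
Qed.

(** The potential is Lipschitz on the half-line from [-a] only; clipping extends
    it from [-a, a] to a bounded Lipschitz function on the line. *)
Definition kantorovich t : R := potential (clip t).

Lemma kantorovich_lip x y : `|kantorovich x - kantorovich y| <= `|x - y|.
Proof.
apply: le_trans (clip_lip x y).
by apply: potential_lip; [have /andP[] := clip_itv x|have /andP[] := clip_itv y].
Qed.

Lemma kantorovich_bound x : `|kantorovich x| <= 2 * a.
Proof.
have p0 : potential (- a) = 0.
  by rewrite /potential set_itv_ge ?Rintegral_set0// bnd_simp ltxx.
have /andP[c1 c2] := clip_itv x.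
have := potential_lip c1 (lexx _); rewrite p0 subr0 => H; apply: le_trans H _.
by rewrite ger0_norm; lra.
Qed.

Lemma bmf_kantorovich : bmf (kantorovich : RT -> R).
Proof.
split; last by exists (2 * a) => x; exact: kantorovich_bound.
apply: continuous_measurable_fun => x0; move: x0 => x; rewrite /continuous_at.
apply/cvgrPdist_le => e e0; near=> y.
apply: le_trans (kantorovich_lip x y) _; near: y.
exact: (@cvgr_dist_le _ _ _ _ _ id x (@cvg_id _ _) e e0).
Unshelve. all: by end_near. Qed.

Let pair_quantile (u : RT) : RT * RT := (quantile g u, quantile h u).

Lemma measurable_pair_quantile : measurable_fun [set: RT] pair_quantile.
Proof. by apply: measurable_fun_pair; exact: measurable_quantile. Qed.

(** The pair of the two quantiles of a uniform variable is a coupling, whose cost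
    [quantile_dist] computes. *)
Lemma wasserstein1_le :
  (wasserstein1 g h <= (mean h (fun=> 1) kantorovich - mean g (fun=> 1) kantorovich)%:E)%E.
Proof.
have [mk [C kC]] := bmf_kantorovich.
pose U : probability RT R := unif.
pose pi : probability (RT * RT)%type R := distribution U (mfun_of measurable_pair_quantile).
apply: (@le_trans _ _ (\int[pi]_z (`|z.1 - z.2|)%:E)%E).
  apply: ereal_inf_lbound; exists pi => // B mB; split.
    rewrite -(quantile_law cg mB); congr (U _).
    by apply/seteqP; split => u //= [].
  rewrite -(quantile_law ch mB); congr (U _).
  by apply/seteqP; split => u //= [].
have mf : measurable_fun [set: RT * RT] (fun z : RT * RT => (`|z.1 - z.2|)%:E).
  by apply/measurable_EFinP; apply: measurableT_comp => //; exact: measurable_funB.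
rewrite (ge0_integral_pushforward measurable_pair_quantile U measurableT mf); last first.
  by move=> z _; rewrite lee_fin.
rewrite preimage_setT.
have bq (p : probability RT R) : carried a p -> bmf (fun u : RT => kantorovich (quantile p u)).
  move=> cp; split; last by exists C => u; exact: kC.
  by apply: measurableT_comp => //; exact: measurable_quantile.
have dU : density U (fun=> 1) := @one_density _ _ _ U.
have Eq (p : probability RT R) : carried a p ->
    mean p (fun=> 1) kantorovich = mean U (fun=> 1) (fun u => kantorovich (quantile p u)).
  move=> cp; rewrite /mean /Rintegral; congr fine.
  have mkE : measurable_fun [set: RT] (fun x : RT => (1 * kantorovich x)%:E).
    by apply/measurable_EFinP; apply: measurable_funM.
  have ik : U.-integrable [set: RT] ((fun x : RT => (1 * kantorovich x)%:E) \o quantile p).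
    exact: (bmf_int dU (bq p cp)).
  rewrite -[RHS](integral_pushforward (measurable_quantile cp) mkE ik measurableT).
  pose m := image_measure U (measurable_quantile cp).
  rewrite -[RHS]/(\int[m]_y (1 * kantorovich y)%:E)%E.
  by apply: eq_measure_integral => A mA _; rewrite [RHS]quantile_law.
rewrite !Eq//.
have bD := bmfD (bq _ ch) (bmfZ (-1) (bq _ cg)).
have -> : mean U (fun=> 1) (fun u => kantorovich (quantile h u)) -
   mean U (fun=> 1) (fun u => kantorovich (quantile g u)) =
   mean U (fun=> 1) (fun u => kantorovich (quantile h u) + -1 * kantorovich (quantile g u)).
  by rewrite (meanD dU (bq _ ch) (bmfZ _ (bq _ cg))) (meanZ dU _ (bq _ cg)) mulN1r.
rewrite /mean /Rintegral fineK; last first.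
  exact: (@integrable_fin_num _ _ _ U _ measurableT _ (bmf_int dU bD)).
rewrite le_eqVlt; apply/orP; left; apply/eqP; apply: eq_integral => u _ /=.
rewrite mul1r mulN1r /kantorovich !clip_id ?quantile_itv//.
by rewrite quantile_dist.
Qed.

End quantile.

(** * Comparison of the rates *)

Section rates.
Context {R : realType} (a b : R) (a0 : 0 < a) (b0 : 0 < b).
Implicit Types n : nat.
Notation r := (rate a b).

Definition rate_const : R := (1 + a / b) `^ (1 / 4) * expR (a / (2 * b)).

Lemma ratio_gt0 : 0 < 1 + a / b.
Proof. by rewrite addr_gt0// divr_gt0. Qed.

Lemma rate_const_gt0 : 0 < rate_const.
Proof. by rewrite mulr_gt0 ?expR_gt0// powR_gt0// ratio_gt0. Qed.

Lemma rateE n : r n = rate_const * n%:R `^ (- (3 / 8)).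
Proof. by []. Qed.

Lemma rate_gt0 n : (0 < n)%N -> 0 < r n.
Proof. by move=> n0; rewrite rateE mulr_gt0 ?rate_const_gt0// powR_gt0// ltr0n. Qed.

Lemma powR_half (x y : R) : 0 < x -> Num.sqrt (x `^ y) = x `^ (y / 2).
Proof.
move=> x0; have -> : x `^ y = (x `^ (y / 2)) ^+ 2.
  by rewrite -powR_mulrn ?powR_ge0// -powRrM; congr (_ `^ _); field.
by rewrite sqrtr_sqr ger0_norm// powR_ge0.
Qed.

Lemma sqrt_rate n : (0 < n)%N ->
  Num.sqrt (r n) = (1 + a / b) `^ (1 / 8) * expR (a / (4 * b)) * n%:R `^ (- (3 / 16)).
Proof.
move=> n0; have p0 : 0 < n%:R :> R by rewrite ltr0n.
rewrite rateE /rate_const !sqrtrM ?mulr_ge0 ?powR_ge0 ?expR_ge0//.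
rewrite !powR_half ?ratio_gt0//; congr (_ `^ _ * _ * _ `^ _); [by field| |by field].
have -> : expR (a / (2 * b)) = expR (a / (4 * b)) ^+ 2.
  by rewrite -expRM_natl; congr expR; field; rewrite gt_eqF.
by rewrite sqrtr_sqr ger0_norm// expR_ge0.
Qed.

Lemma ln_rate n : (0 < n)%N -> ln (1 / r n) = 3 / 8 * ln n%:R - ln rate_const.
Proof.
move=> n0; have p0 : 0 < n%:R :> R by rewrite ltr0n.
rewrite div1r lnV ?posrE ?rate_gt0// rateE lnM ?posrE ?rate_const_gt0 ?powR_gt0//.
by rewrite ln_powR; ring.
Qed.

Lemma ln_near (A : R) : \forall n \near \oo, (0 < n)%N /\ A <= ln n%:R.
Proof.
near=> n; have n0 : (0 < n)%N by near: n; exact: nbhs_infty_gt.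
split=> //; have p0 : 0 < n%:R :> R by rewrite ltr0n.
rewrite -[A]expRK ler_ln ?posrE ?expR_gt0//.
near: n; exact: nbhs_infty_ger.
Unshelve. all: by end_near. Qed.

(** As [ln (1 / rate) = 3/8 * ln n - c] with a constant [c], the two logarithms are
    eventually within a factor 4. *)
Lemma rate_near : \forall n \near \oo, [/\ (0 < n)%N, r n <= 1, 1 <= ln (1 / r n),
   ln (1 / r n) <= ln n%:R & ln n%:R <= 4 * ln (1 / r n)].
Proof.
near=> n.
have [n0 An] : (0 < n)%N /\ 8 * `|ln rate_const| + 8 <= ln n%:R by near: n; exact: ln_near.
have c1 := ler_norm (ln rate_const); have c2 := ler_norm (- ln rate_const); rewrite normrN in c2.
have l0 := normr_ge0 (ln rate_const).
have E := ln_rate n0.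
have l1 : 1 <= ln (1 / r n) by rewrite E; lra.
split=> //; rewrite ?E; try lra.
have := rate_gt0 n0 => r0.
rewrite -ler_ln ?posrE// ln1; move: l1; rewrite div1r lnV ?posrE//; lra.
Unshelve. all: by end_near. Qed.

End rates.

Section stochastic_order.
Context d (Omega : measurableType d) (R : realType) (P : probability Omega R).
Implicit Types (Y : nat -> Omega -> \bar R) (r s : nat -> R).

Lemma bigO_p_le Y r s (C : R) : 0 < C -> (\forall n \near \oo, r n <= C * s n) ->
  bigO_p P Y r -> bigO_p P Y s.
Proof.
move=> C0 rs Yr eps e0; have [M M0 H] := Yr eps e0.
exists (M * C); first exact: mulr_gt0.
near=> n; apply: (@le_trans _ _ (mu_ext P [set w | ((M * r n)%:E < `|Y n w|)%E])).
  apply: le_mu_ext => w /=; apply: le_lt_trans; rewrite lee_fin -mulrA ler_wpM2l ?(ltW M0)//.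
  by near: n; exact: rs.
near: n; exact: H.
Unshelve. all: by end_near. Qed.

End stochastic_order.

Section wasserstein_bound.
Context {R : realType} (a b : R) (a0 : 0 < a) (b0 : 0 < b).
Notation mu := (@lebesgue_measure R).
Implicit Types g h : probability (measurableTypeR R) R.

Lemma wasserstein1_ge0 g h : (0 <= wasserstein1 g h)%E.
Proof.
by apply: le_ereal_inf_tmp => _ [pi _ <-]; apply: integral_ge0 => z _; rewrite lee_fin.
Qed.

(** The constant [2 * a] bounds the potential on [-a, a], where it vanishes at [-a]. *)
Lemma wasserstein1_le_L1 g h (s e : R) : carried a g -> carried a h -> 0 < s ->
  ('N[mu]_1 [EFin \o (mixture_pdf a b g \- mixture_pdf a b h)%R] <= e%:E)%E ->
  (wasserstein1 g h <= (2 * s + (2 * a + 8 * b ^+ 2 / s) * e)%:E)%E.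
Proof.
move=> cg ch s0 Le; apply: le_trans (wasserstein1_le a0 cg ch) _; rewrite lee_fin.
apply: le_trans (dual_le_L1 b0 ch cg s0 (bmf_kantorovich a0 g h)
  (kantorovich_lip a0 g h) (kantorovich_bound a0 g h)) _.
rewrite lerD2l ler_wpM2l//.
  by rewrite addr_ge0 ?divr_ge0 ?mulr_ge0 ?sqr_ge0// ltW.
rewrite -lee_fin; apply: le_trans Le; rewrite (L1_normE b0 ch cg) lee_fin.
rewrite le_eqVlt; apply/orP; left; apply/eqP.
by apply: eq_Rintegral => x _; rewrite distrC.
Qed.

End wasserstein_bound.

Theorem corollary5p2 (R : realType) (a b : R) (a_gt0 : 0 < a) (b_gt0 : 0 < b)
    (g0 : probability (measurableTypeR R) R) (g0_carried : carried a g0)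
    (d : measure_display) (Omega : measurableType d) (P : probability Omega R)
    (theta Z : nat -> {RV P >-> measurableTypeR R})
    (theta_indep : independent_seq theta)
    (theta_law : forall (i : nat) (B : set (measurableTypeR R)), measurable B ->
       distribution P (theta i) B = g0 B)
    (Z_indep : independent_seq Z)
    (Z_law : forall (i : nat) (B : set (measurableTypeR R)), measurable B ->
       distribution P (Z i) B = (\int[lebesgue_measure]_(x in B) (laplace_pdf b x)%:E)%E)
    (theta_Z_indep : independent_of theta Z)
    (X : nat -> Omega -> R)
    (X_def : forall (i : nat) (w : Omega), X i w = theta i w + Z i w)
    (ghat : nat -> Omega -> probability (measurableTypeR R) R)
    (ghat_npmle : forall (n : nat) (w : Omega), (0 < n)%N ->
       is_npmle a b n (fun i => X i w) (ghat n w)) :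
  let L1_error : nat -> Omega -> \bar R := fun n w =>
    ('N[lebesgue_measure]_1
       [EFin \o (mixture_pdf a b (ghat n w) \- mixture_pdf a b g0)%R])%E in
  let W1_error : nat -> Omega -> \bar R :=
    fun n w => wasserstein1 (ghat n w) g0 in
  let r : nat -> R := rate a b in
  let W1_rate : nat -> R := fun n => a * r n + b * Num.sqrt (r n * ln (1 / r n)) in
  let term1 : nat -> R := fun n =>
    a * (1 + a / b) `^ (1 / 4) * expR (a / (2 * b)) * n%:R `^ (- (3 / 8)) in
  let term2 : nat -> R := fun n =>
    b * (1 + a / b) `^ (1 / 8) * expR (a / (4 * b)) * n%:R `^ (- (3 / 16))
      * Num.sqrt (ln n%:R) in
  [/\ bigO_p P L1_error r,
      bigO_p P W1_error W1_rate,
      (forall Y : nat -> Omega -> \bar R,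
         bigO_p P Y W1_rate <-> bigO_p P Y (fun n => term1 n + term2 n))
        /\ bigO_p P W1_error (fun n => term1 n + term2 n)
    & (term1 n / term2 n) @[n --> \oo] --> (0 : R)
        /\ bigO_p P W1_error
             (fun n => n%:R `^ (- (3 / 16)) * Num.sqrt (ln n%:R)) ].
Proof.
move=> L1_error W1_error r W1_rate term1 term2.
have a0 := a_gt0; have b0 := b_gt0.
have mX := measurable_X X_def.
have lawX := X_law b0 g0_carried theta_law Z_law theta_Z_indep X_def.
have indX := X_indep theta_indep Z_indep theta_Z_indep X_def.
have c0 := rate_const_gt0 a0 b0.
have L1_all eps : 0 < eps -> exists2 K : R, 0 < K & forall n, (0 < n)%N ->
    (mu_ext P [set w | ((K * r n)%:E < L1_error n w)%E] <= eps%:E)%E.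
  (* [T] makes the exceptional event of probability at most [eps], and
     [h = n^(-1/4)] turns the bound [sqrt (h^3)] into the rate up to [rate_const]. *)
  move=> e0; pose T := 2 / eps; have T0 : 0 < T by rewrite divr_gt0.
  pose K1 := expR (llr_range a b) * ((1 + llr_sq_c a b T) / 2).
  exists (`|K1 / rate_const a b| + 1); first by rewrite ltr_wpDl.
  case=> // p _; pose h : R := p.+1%:R `^ (- (1 / 4)).
  have p0 : 0 < p.+1%:R :> R by rewrite ltr0n.
  have h0 : 0 < h by exact: powR_gt0.
  have hpow k : h ^+ k = p.+1%:R `^ (- (1 / 4) * k%:R) by rewrite powRrM powR_mulrn ?powR_ge0.
  have h1 : h <= 1.
    have : p.+1%:R `^ (- (1 / 4)) <= p.+1%:R `^ 0 :> R by apply: ler_powR; [rewrite ler1n|lra].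
    by rewrite powRr0.
  have nh : p.+1%:R * h ^+ 4 = 1.
    rewrite hpow -[X in X * _](powRr1 (ltW p0)) -powRD ?(gt_eqF p0) ?implybT//.
    by rewrite (_ : 1 + _ = 0) ?powRr0//; lra.
  have sh : Num.sqrt (h ^+ 3) = r p.+1 / rate_const a b.
    have -> : r p.+1 / rate_const a b = p.+1%:R `^ (- (3 / 8)).
      by rewrite [r _]rateE mulrC mulKf// gt_eqF.
    by rewrite hpow powR_half//; congr (_ `^ _); lra.
  have := L1_deviation a0 b0 g0_carried mX lawX indX h0 h1 nh T0
    (fun w => ghat_npmle p.+1 w isT).
  rewrite (_ : 2 / T = eps); last by rewrite /T; field; rewrite gt_eqF.
  apply: le_trans; apply: le_mu_ext => w /=; apply: le_lt_trans.
  rewrite lee_fin sh -/K1 mulrCA mulrC ler_wpM2r ?(ltW (rate_gt0 _ _ _))//.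
  by apply: le_trans (ler_norm _) _; rewrite lerDl.
have L1_ge0 n w : (0 <= L1_error n w)%E by exact: Lnorm_ge0.
have W1_ge0 n w : (0 <= W1_error n w)%E by exact: wasserstein1_ge0.
have L1_rate : bigO_p P L1_error r.
  move=> eps e0; have [K K0 HK] := L1_all eps e0; exists K => //.
  near=> n; under eq_set do rewrite gee0_abs//.
  by apply: HK; near: n; exact: nbhs_infty_gt.
have W1_raw : bigO_p P W1_error (fun n => r n + Num.sqrt (r n)).
  move=> eps e0; have [K K0 HK] := L1_all eps e0.
  exists (2 * a * K + (2 + 8 * b ^+ 2 * K)).
    by rewrite addr_gt0 ?ltr_wpDr ?mulr_gt0 ?mulr_ge0 ?sqr_ge0// ltW.
  near=> n; have n0 : (0 < n)%N by near: n; exact: nbhs_infty_gt.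
  apply: le_trans (HK n n0); apply: le_mu_ext => w /=.
  rewrite gee0_abs//; apply: contraPlt => Lw; apply/negP; rewrite -leNgt.
  (* the window [s = sqrt (r n)] balances the terms [s] and [r n / s] *)
  have r0 : 0 < r n := rate_gt0 a0 b0 n0; set s := Num.sqrt (r n).
  have s0 : 0 < s by rewrite sqrtr_gt0.
  have s2 : r n = s ^+ 2 by rewrite sqr_sqrtr// ltW.
  have [cg _] := ghat_npmle n w n0.
  apply: le_trans (wasserstein1_le_L1 a0 b0 cg g0_carried s0 Lw) _.
  rewrite lee_fin s2.
  have -> : 2 * s + (2 * a + 8 * b ^+ 2 / s) * (K * s ^+ 2) =
     2 * a * K * s ^+ 2 + (2 + 8 * b ^+ 2 * K) * s by field; rewrite gt_eqF.
  rewrite [leRHS]mulrDl; apply: lerD; apply: ler_wpM2l.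
  - by rewrite !mulr_ge0// ltW.
  - by rewrite lerDl ltW.
  - by rewrite addr_ge0 ?mulr_ge0 ?sqr_ge0// ltW.
  - by rewrite lerDr sqr_ge0.
have term1E n : term1 n = a * r n by rewrite /term1 [r n]rateE /rate_const !mulrA.
have term2E n : (0 < n)%N -> term2 n = b * Num.sqrt (r n) * Num.sqrt (ln n%:R).
  by move=> n0; rewrite /term2 sqrt_rate// !mulrA.
have near_rates : \forall n \near \oo, [/\ r n + Num.sqrt (r n) <= (1 / a + 1 / b) * W1_rate n,
    W1_rate n <= 1 * (term1 n + term2 n), term1 n + term2 n <= 2 * W1_rate n &
    term1 n + term2 n <= (a + b) * ((1 + a / b) `^ (1 / 8) * expR (a / (4 * b))) *
      (n%:R `^ (- (3 / 16)) * Num.sqrt (ln n%:R))].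
  near=> n.
  have [n0 r1 l1 ln4 l4] : [/\ (0 < n)%N, r n <= 1, 1 <= ln (1 / r n),
     ln (1 / r n) <= ln n%:R & ln n%:R <= 4 * ln (1 / r n)].
    by near: n; exact: rate_near.
  have r0 : 0 < r n := rate_gt0 a0 b0 n0.
  have sr1 : Num.sqrt (r n) <= 1 by rewrite -sqrtr1 ler_wsqrtr.
  have sr0 := sqrtr_ge0 (r n).
  have rs : r n <= Num.sqrt (r n) by rewrite -{1}(sqr_sqrtr (ltW r0)) expr2 ler_piMl.
  set l := ln (1 / r n) in l1 ln4 l4 *; set m := ln n%:R in ln4 l4 *.
  have sl1 : 1 <= Num.sqrt l by rewrite -sqrtr1 ler_wsqrtr.
  have slm : Num.sqrt l <= Num.sqrt m by rewrite ler_wsqrtr.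
  have sm2 : Num.sqrt m <= 2 * Num.sqrt l.
    have -> : 2 * Num.sqrt l = Num.sqrt (4 * l).
      rewrite sqrtrM// (_ : 4 = 2 ^+ 2 :> R) ?sqrtr_sqr ?ger0_norm//; by ring.
    by rewrite ler_wsqrtr.
  have srl : Num.sqrt (r n * l) = Num.sqrt (r n) * Num.sqrt l by rewrite sqrtrM// ltW.
  rewrite /W1_rate term1E term2E// -/l -/m srl.
  have sr_sl : Num.sqrt (r n) <= Num.sqrt (r n) * Num.sqrt l by rewrite ler_peMr.
  have sr_lm : Num.sqrt (r n) * Num.sqrt l <= Num.sqrt (r n) * Num.sqrt m by rewrite ler_wpM2l.
  have sr_ml : Num.sqrt (r n) * Num.sqrt m <= 2 * (Num.sqrt (r n) * Num.sqrt l).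
    by rewrite mulrCA ler_wpM2l.
  split.
  - rewrite [X in _ <= X](_ : _ = r n + Num.sqrt (r n) * Num.sqrt l +
      (b / a * (Num.sqrt (r n) * Num.sqrt l) + a / b * r n)); last first.
      by field; rewrite !gt_eqF.
    rewrite -[X in X <= _]addr0; apply: lerD; first by rewrite lerD2l.
    have sl0 := sqrtr_ge0 l; have ab0 := divr_ge0 (ltW a0) (ltW b0).
    have ba0 := divr_ge0 (ltW b0) (ltW a0); have := ltW r0 => r0'.
    by apply: addr_ge0; apply: mulr_ge0 => //; exact: mulr_ge0.
  - by rewrite mul1r lerD2l -mulrA ler_wpM2l// ltW.
  - rewrite mulrDr; apply: lerD; first by rewrite ler_peMl ?ler1n// ltW// mulr_gt0.
    by rewrite -mulrA [2 * _]mulrCA ler_wpM2l// ltW.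
  - rewrite [X in _ <= X](_ : _ = (a + b) * Num.sqrt (r n) * Num.sqrt m); last first.
      by rewrite sqrt_rate// !mulrA.
    rewrite -!mulrA mulrDl; apply: lerD => //.
    by rewrite ler_wpM2l ?(ltW a0)//; apply: le_trans rs _; apply: le_trans sr_sl sr_lm.
have W1_O : bigO_p P W1_error W1_rate.
  apply: (bigO_p_le (_ : 0 < 1 / a + 1 / b) _ W1_raw); first by rewrite addr_gt0 ?divr_gt0.
  by near=> n; have [] : _ := near near_rates n.
have terms_O : bigO_p P W1_error (fun n => term1 n + term2 n).
  apply: (bigO_p_le ltr01 _ W1_O).
  by near=> n; have [] : _ := near near_rates n.
split=> //.
- split=> // Y; split.
    by apply: (bigO_p_le ltr01); near=> n; have [] : _ := near near_rates n.
  by apply: (bigO_p_le (_ : 0 < 2)) => //; near=> n; have [] : _ := near near_rates n.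
split.
  apply/cvgrPdist_le => e e0; near=> n.
  have [n0 r1 l1 ln4 l4] : [/\ (0 < n)%N, r n <= 1, 1 <= ln (1 / r n),
     ln (1 / r n) <= ln n%:R & ln n%:R <= 4 * ln (1 / r n)].
    by near: n; exact: rate_near.
  have [_ lA] : (0 < n)%N /\ (a / b / e) ^+ 2 <= ln n%:R by near: n; exact: ln_near.
  have r0 : 0 < r n := rate_gt0 a0 b0 n0; set s := Num.sqrt (r n).
  have s0 : 0 < s by rewrite sqrtr_gt0.
  have s1 : s <= 1 by rewrite /s -sqrtr1 ler_wsqrtr.
  set l := Num.sqrt (ln (n%:R : R)).
  have lAe : a / b / e <= l.
    rewrite -(@ger0_norm _ (a / b / e)) ?divr_ge0 ?(ltW a0) ?(ltW b0) ?(ltW e0)//.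
    by rewrite -sqrtr_sqr ler_wsqrtr.
  have l0 : 0 < l by apply: lt_le_trans lAe; rewrite !divr_gt0.
  rewrite term1E term2E// -/s -/l -(sqr_sqrtr (ltW r0)) -/s.
  rewrite (_ : a * s ^+ 2 / _ = a / b / l * s); last by field; rewrite !gt_eqF.
  have q0 : 0 <= a / b / l by apply/ltW; rewrite !divr_gt0.
  rewrite sub0r normrN ger0_norm; last by apply: mulr_ge0 => //; exact: ltW.
  apply: le_trans (_ : a / b / l <= _); first by rewrite ler_piMr.
  by rewrite ler_pdivrMr// [e * _]mulrC -ler_pdivrMr.
apply: (bigO_p_le (_ : 0 < (a + b) * ((1 + a / b) `^ (1 / 8) * expR (a / (4 * b)))) _ terms_O).
  by rewrite !mulr_gt0 ?addr_gt0 ?expR_gt0// powR_gt0// ratio_gt0.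
by near=> n; have [] : _ := near near_rates n.
Unshelve. all: by end_near. Qed.
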